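(* Let $p\in(1,2)$ and assume that $M_1\in\ell^2(\mu)$ and $M_2\in\ell^1(\mu)$. Then for any $f\in\mathcal{P}_*^+(X)$ and any $t>0$, $$\frac{d}{dt}\mathcal{H}_p(P_tf)=-\mathcal{I}_p(P_tf)$$ and $$\frac{d^2}{dt^2}\mathcal{H}_p(P_tf)=2\int_XP_tf\;\Psi^{(p)}_{2,\Upsilon}(P_tf)\,d\mu.$$ In particular, if the Markov generator $L$ satisfies $CD^{(p)}_\Upsilon(\kappa,\infty)$ (with $\kappa\in\mathbb{R}$), then $$\frac{d^2}{dt^2}\mathcal{H}_p(P_tf)\ge-2\kappa\,\frac{d}{dt}\mathcal{H}_p(P_tf)$$ for any $t>0$ and any $f\in\mathcal{P}_*^+(X)$.
   Context: Setting. $X$ is a finite or countably infinite set and $k:X\times X\to\mathbb{R}$ are transition rates of a continuous-time Markov chain $(Z_t)_{t\ge0}$ on $X$: $k(x,y)\ge 0$ for $x\neq y$ and $k(x,x)=-\sum_{y\neq x}k(x,y)<0$. The generator is $Lf(x)=\sum_{y\in X}k(x,y)(f(y)-f(x))$. Standing assumptions: the chain is irreducible (for all $x,y\in X$ there are $x=z_1,\dots,z_m=y$, $m\ge2$, with $k(z_i,z_{i+1})>0$); its invariant measure, unique up to positive multiples, can be normalized to a probability measure $\mu$ with density $\pi:X\to(0,\infty)$ with respect to counting measure; detailed balance $\pi(x)k(x,y)=\pi(y)k(y,x)$ holds; for every $x\in X$, $$M_1(x):=\sum_{y\neq x}k(x,y)<\infty,\qquad M_2(x):=\sum_{y\neq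 x}k(x,y)\sum_{z\neq y}k(y,z)<\infty;$$ and the semigroup $P_tf(x)=\mathbb{E}(f(Z_t)\mid Z_0=x)$ is Markov, i.e. $P_t1=1$ (the chain is non-explosive). Function classes. $\ell^p(\mu)$: $p$-summable functions with respect to $\mu$. $\ell^{\infty,+}(X)$: bounded $f:X\to\mathbb{R}$ with $\inf_Xf>0$. $\mathcal{P}_*^+(X)$: those $f\in\ell^{\infty,+}(X)$ with $\sum_xf(x)\pi(x)=1$. Power type entropy. For $p\in(1,2)$, $\Phi_p(r)=\frac{r^p-r}{p(p-1)}$ for $r\ge0$, and $\mathcal{H}_p(\rho)=\sum_x\Phi_p(\rho(x))\pi(x)$. Operators. Let $\Upsilon(r)=e^r-1-r$ and $B_{\Upsilon'}(f,g)(x)=\sum_y k(x,y)\Upsilon'(f(y)-f(x))(g(y)-g(x))$. For a differentiable function $H$ put $\Lambda_H(w,z)=H(w)-H(z)-H'(z)(w-z)$. For $f\in\ell^{\infty,+}(X)$, $$\Psi^{(p)}_\Upsilon(f)(x)=-\sum_{y}k(x,y)\Lambda_{\Phi_p'}(f(y),f(x)),\qquad \Psi^{(p)}_{2,\Upsilon}(f)=\tfrac12\Big(L\Psi^{(p)}_\Upsilon(f)-B_{\Upsilon'}\big(\log f,L\Phi_p'(f)\big)\Big).$$ For $\rho\in\mathcal{P}_*^+(X)$, $\mathcal{I}_p(\rho)=\frac1{2-p}\int_X\rho\,\Psi^{(p)}_\Upsilon(\rho)\,d\mu$. $L$ satisfies $CD_\Upsilon^{(p)}(\kappa,\infty)$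 if $\Psi^{(p)}_{2,\Upsilon}(f)(x)\ge\frac{\kappa}{2-p}\Psi^{(p)}_\Upsilon(f)(x)$ for all $x\in X$ and all $f\in\ell^{\infty,+}(X)$. *)

(* Defs.v *)
From HB Require Import structures.
From mathcomp Require Export all_boot all_order all_algebra.
From mathcomp Require Export all_classical all_reals all_analysis.
Export Order.TTheory GRing.Theory Num.Theory.
Export numFieldNormedType.Exports.

Set Implicit Arguments.
Unset Strict Implicit.
Unset Printing Implicit Defensive.

Local Open Scope classical_set_scope.
Local Open Scope ring_scope.

(** A finite or countably infinite set is a [measurableType] whose sigma-algebra
    is the power set and whose underlying set is countable.  A sum over [X] is
    an integral against [counting]. *)
Definition countable_discrete d (X : measurableType d) : Prop :=
  countable [set: X] /\ forall A : set X, measurable A.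

Section Rates.
Context {R : realType} {d : measure_display} {X : measurableType d}.
Variable k : X -> X -> R.
Local Open Scope ereal_scope.

Definition M1 (x : X) : \bar R :=
  \int[counting]_(y in ~` [set x]) (k x y)%:E.

Definition M2 (x : X) : \bar R :=
  \int[counting]_(y in ~` [set x]) ((k x y)%:E * M1 y).

Local Close Scope ereal_scope.

Record is_rates : Prop := IsRates {
  rates_ge0 : forall x y, x != y -> 0 <= k x y;
  rates_M1 : forall x, (M1 x < +oo)%E;
  rates_M2 : forall x, (M2 x < +oo)%E;
  rates_diag : forall x, k x x = - fine (M1 x);
  rates_diag_lt0 : forall x, k x x < 0 }.

(** The states are [x = z_1] and [s = z_2, ..., z_m] with [m >= 2]. *)
Definition irreducible : Prop :=
  forall x y, exists s : seq X,
    [/\ s != [::], path (fun a b => 0 < k a b) x s & last x s = y].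

End Rates.

Section Chain.
Context {R : realType} {d : measure_display} {X : measurableType d}
  {d' : measure_display} {Omega : measurableType d'}.

(** [None] is the cemetery reached at explosion.  Before explosion a path is
    right-continuous with left limits in [X] for the discrete topology, i.e. it
    has finitely many jumps on every compact interval. *)
Record is_jump_path (w : R -> option X) : Prop := IsJumpPath {
  path_rcont : forall t, 0 <= t -> w t != None ->
    \forall s \near t^'+, w s = w t;
  path_llim : forall t, 0 < t -> w t != None ->
    exists y, \forall s \near t^'-, w s = Some y;
  path_cemetery : forall s t, 0 <= s -> s <= t -> w s = None -> w t = None }.

(** [Pr x] is the law of the chain conditioned on [Z_0 = x]; only times [t >= 0]
    are meaningful. *)
Variables (Pr : X -> probability Omega R) (Z : R -> Omega -> option X).

Definition at_state (t : R) (x : X) : set Omega := [set w | Z t w = Some x].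

Definition history (h : seq (R * X)) : set Omega :=
  [set w | forall u, u \in h -> Z u.1 w = Some u.2].

Record is_markov_chain (k : X -> X -> R) : Prop := IsMarkovChain {
  chain_measurable : forall t x, 0 <= t -> measurable (at_state t x);
  chain_paths : forall w, is_jump_path (Z ^~ w);
  chain_start : forall x, Pr x (at_state 0 x) = 1%E;
  chain_markov : forall (x : X) (h : seq (R * X)) (s t : R) (y z : X),
    0 <= s -> 0 <= t -> (forall u, u \in h -> 0 <= u.1 <= s) ->
    Pr x (history h `&` at_state s y `&` at_state (s + t) z) =
      (Pr x (history h `&` at_state s y) * Pr y (at_state t z))%E;
  chain_rates : forall x y,
    (fine (Pr x (at_state t y)) - (x == y)%:R) / t @[t --> 0^'+] --> k x y }.

(** Functions on [X] are extended by [0] to the cemetery. *)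
Definition semigroup (t : R) (f : X -> R) (x : X) : R :=
  fine ('E_(Pr x)[fun w => oapp f 0 (Z t w)]).

Definition markov_semigroup : Prop :=
  forall t, 0 <= t -> semigroup t (cst 1) = cst 1.

Definition is_invariant (mu : probability X R) : Prop :=
  forall t y, 0 <= t -> (\int[mu]_x Pr x (at_state t y))%E = mu [set y].

End Chain.

Section Density.
Context {R : realType} {d : measure_display} {X : measurableType d}.

Definition has_density (mu : probability X R) (pi : X -> R) : Prop :=
  (forall x, 0 < pi x) /\
  (forall A, mu A = \int[counting]_(x in A) (pi x)%:E)%E.

Definition detailed_balance (k : X -> X -> R) (pi : X -> R) : Prop :=
  forall x y, pi x * k x y = pi y * k y x.

End Density.

Section Entropy.
Context {R : realType} {d : measure_display} {X : measurableType d}.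

Definition linfty_pos (f : X -> R) : Prop :=
  bounded_fun f /\ 0 < inf (range f).

Definition prob_densities (pi : X -> R) (f : X -> R) : Prop :=
  linfty_pos f /\ \int[counting]_x (f x * pi x) = 1.

Definition Phi (p r : R) : R := (r `^ p - r) / (p * (p - 1)).

Definition entropy (pi : X -> R) (p : R) (rho : X -> R) : R :=
  \int[counting]_x (Phi p (rho x) * pi x).

Definition Upsilon (r : R) : R := expR r - 1 - r.

Definition Lambda (H : R -> R) (w z : R) : R :=
  H w - H z - H^`()%classic z * (w - z).

Variable k : X -> X -> R.

Definition generator (f : X -> R) (x : X) : R :=
  \int[counting]_y (k x y * (f y - f x)).

Definition B_Upsilon' (f g : X -> R) (x : X) : R :=
  \int[counting]_y (k x y * Upsilon^`()%classic (f y - f x) * (g y - g x)).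

Definition Psi (p : R) (f : X -> R) (x : X) : R :=
  - \int[counting]_y (k x y * Lambda (Phi p)^`()%classic (f y) (f x)).

Definition Psi2 (p : R) (f : X -> R) (x : X) : R :=
  2^-1 * (generator (Psi p f) x
          - B_Upsilon' (@ln R \o f) (generator ((Phi p)^`()%classic \o f)) x).

Definition fisher (mu : probability X R) (p : R) (rho : X -> R) : R :=
  (2 - p)^-1 * \int[mu]_x (rho x * Psi p rho x).

Definition CD_Upsilon (p kappa : R) : Prop :=
  forall (f : X -> R) (x : X), linfty_pos f ->
    Psi2 p f x >= kappa / (2 - p) * Psi p f x.

End Entropy.

(* Main.v *)
Require Import Defs.
From mathcomp Require Import measurable_realfun ring lra.

(** Write [u t = P_t f].  Conservativity and convergence of [P_h(x,y)/h] to
    [k(x,y)] make the measures [P_h(x,.)/h] off [x] converge to [k(x,.)] in total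
    variation (Scheffe), so for each state [x] the Kolmogorov backward equation
    [d/dt u t x = L (u t) x] holds pointwise, for any bounded [f].

    Let [W = 1 + sum_y |k(.,y)|] and [V = sum_y |k(.,y)| (W + W(y))].  If [b] is
    bounded then [L b = O(W)], and if [b = O(W)] then [L b = O(V)]; the moment
    hypotheses say that [W^2] and [V] are [mu]-integrable.  Hence one may
    differentiate twice under the sum:
      H'  = int Phi'(u) L u   and   H'' = int Phi''(u) (L u)^2 + Phi'(u) L L u,
    and detailed balance gives [int a L b = int b L a] for [a] bounded and
    [b = O(W)].  With [r Phi''(r) = (p - 1) Phi'(r) + 1/p] and
    [u Upsilon'(log u(y) - log u) = u(y) - u] these symmetries turn the two
    integrals into [- I_p(u)] and [2 int u Psi_2(u)]. *)

Set Implicit Arguments.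
Unset Strict Implicit.
Unset Printing Implicit Defensive.

Local Open Scope classical_set_scope.
Local Open Scope ring_scope.

(** * Integration on a countable discrete space *)

Section DiscreteSpace.
Context {R : realType} {d : measure_display} {X : measurableType d}.
Hypothesis hX : countable_discrete X.
Local Notation cnt := (@counting X R).
Local Open Scope ereal_scope.

Lemma discrete_measurable (A : set X) : measurable A.
Proof. by case: hX. Qed.

Lemma discrete_measurable_fun d' (T : sigmaRingType d') (D : set X) (f : X -> T) :
  measurable_fun D f.
Proof. by move=> _ Y _; exact: discrete_measurable. Qed.

(** The atoms are the fibres of an injection of [X] into [nat]. Allowing empty fibres treats finite
    and infinite [X] at once. *)
Lemma discrete_atoms : exists F : nat -> set X,
  [/\ trivIset setT F, \bigcup_n F n = setT &
      forall n, F n = set0 \/ exists x, F n = [set x]].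
Proof.
case: hX => /countable_injP[f injf] _.
exists (fun n => f @^-1` [set n]); split.
- by apply/trivIsetP => i j _ _ ij; apply/seteqP; split=> // x [/= fi fj];
    move: ij; rewrite -fi -fj eqxx.
- by apply/seteqP; split=> // x _; exists (f x).
- move=> n; case: (pselect (exists x, f x = n)) => [[x fx]|nx].
    right; exists x; apply/seteqP; split=> [y /= fy|y ->//].
    by apply: injf; rewrite ?inE// fy fx.
  by left; apply/seteqP; split=> // x fx; apply: nx; exists x.
Qed.

Lemma counting_set1 (x : X) : cnt [set x] = 1.
Proof.
rewrite /counting asboolT; last exact: finite_set1.
by rewrite fset_set1 finmap.cardfs1.
Qed.

Lemma integral_discrete_set1 (nu : {measure set X -> \bar R}) (g : X -> \bar R) x :
  0 <= g x -> \int[nu]_(y in [set x]) g y = g x * nu [set x].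
Proof.
move=> g0; rewrite -integral_cst; last exact: discrete_measurable.
by apply: eq_integral => y; rewrite inE => ->.
Qed.

(** Cutting the counting integral along the atoms turns it into a series of nonnegative terms, and
    such a series commutes with integration against any measure [nu], sigma-finite or not. *)
Lemma tonelli_counting d' (T : measurableType d') (nu : {measure set T -> \bar R})
    (H : T -> X -> \bar R) :
  (forall x, measurable_fun setT (H ^~ x : T -> \bar R)) -> (forall w x, 0 <= H w x) ->
  \int[nu]_w \int[cnt]_x H w x = \int[cnt]_x \int[nu]_w H w x.
Proof.
move=> mH H0; have [F [tF UF F1]] := discrete_atoms.
have split_cnt (g : X -> \bar R) : (forall x, 0 <= g x) ->
    \int[cnt]_x g x = \sum_(n <oo) \int[cnt]_(x in F n) g x.
  move=> g0; rewrite -UF ge0_integral_bigcup//.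
  - by move=> n; exact: discrete_measurable.
  - exact: discrete_measurable_fun.
rewrite [RHS]split_cnt; last by move=> x; exact: integral_ge0.
under eq_integral do rewrite split_cnt//.
have at1 (w : T) x : \int[cnt]_(y in [set x]) H w y = H w x.
  by rewrite integral_discrete_set1// -[RHS]mule1 -(counting_set1 x).
rewrite integral_nneseries//; first last.
- by move=> n w _; exact: integral_ge0.
- move=> n; case: (F1 n) => [->|[x ->]].
    by under eq_fun do rewrite integral_set0; exact: measurable_cst.
  by under eq_fun do rewrite at1; exact: mH.
apply: eq_eseriesr => n _; case: (F1 n) => [->|[x ->]].
  rewrite integral_set0; under eq_integral do rewrite integral_set0.
  by rewrite integral0.
under eq_integral do rewrite at1.
rewrite integral_discrete_set1; last exact: integral_ge0.
by rewrite -[LHS]mule1 -(counting_set1 x).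
Qed.

Lemma integral_counting_atom (x : X) (h : X -> \bar R) :
  0 <= h x -> (forall y, y != x -> h y = 0) -> \int[cnt]_y h y = h x.
Proof.
move=> h0 hy0.
transitivity (\int[cnt]_(y in [set x]) h y).
  rewrite [RHS]integral_mkcond; apply: eq_integral => y _.
  rewrite patchE; case: ifPn => //.
  by rewrite notin_setE/= => /eqP/hy0.
by rewrite integral_discrete_set1// -[RHS]mule1 -(counting_set1 x).
Qed.

(** [G] is the sum over [x] of [g x] times the indicator of [F x], with at most one nonzero term at
    each point, so Tonelli applies. The sets need not cover [T]; on the law of the chain the
    remainder is the explosion event. *)
Lemma integral_countable_partition d' (T : measurableType d')
    (nu : {measure set T -> \bar R}) (F : X -> set T) (g : X -> \bar R)
    (G : T -> \bar R) :
  (forall x, measurable (F x)) -> (forall x y w, F x w -> F y w -> x = y) ->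
  (forall x, 0 <= g x) -> (forall x w, F x w -> G w = g x) ->
  (forall w, (forall x, ~ F x w) -> G w = 0) ->
  \int[nu]_w G w = \int[cnt]_x (g x * nu (F x)).
Proof.
move=> mF tF g0 GF G0.
transitivity (\int[nu]_w \int[cnt]_x (g x * (\1_(F x) w)%:E)).
  apply: eq_integral => w _.
  case: (pselect (exists x, F x w)) => [[x Fxw]|nF].
    rewrite (@integral_counting_atom x).
    - by rewrite indicE mem_set// mule1 (GF x).
    - by rewrite mule_ge0 // lee_fin.
    - move=> y yx; rewrite indicE memNset ?mule0// => Fyw.
      by move: yx; rewrite (tF _ _ _ Fxw Fyw) eqxx.
  rewrite G0; last by move=> x Fxw; apply: nF; exists x.
  rewrite integral0_eq// => x _; rewrite indicE memNset ?mule0// => Fxw.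
  by apply: nF; exists x.
rewrite tonelli_counting.
- apply: eq_integral => x _; rewrite ge0_integralZl//.
  + by rewrite integral_indic// setIT.
  + exact/measurable_EFinP.
- move=> x; apply: emeasurable_funM => //; exact/measurable_EFinP.
- by move=> w x; rewrite mule_ge0 // lee_fin.
Qed.

End DiscreteSpace.

(** * Absolutely convergent real sums over the state space *)

Definition summ {R : realType} {d : measure_display} {X : measurableType d}
  (f : X -> R) : Prop := (@counting X R).-integrable setT (EFin \o f).

Section Sums.
Context {R : realType} {d : measure_display} {X : measurableType d}.
Hypothesis hX : countable_discrete X.
Local Notation cnt := (@counting X R).
Implicit Types (f g : X -> R) (h : X -> X -> R).

Let mfun (D : set X) (f : X -> \bar R) : measurable_fun D f.
Proof. exact: discrete_measurable_fun. Qed.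

Lemma le_summ f g : (forall x, `|f x| <= g x) -> summ g -> summ f.
Proof.
move=> fg; apply: le_integrable => //= x _; rewrite lee_fin.
by rewrite (le_trans (fg x)) ?ler_norm.
Qed.

Lemma summD f g : summ f -> summ g -> summ (fun x => f x + g x).
Proof. by move=> sf sg; exact: (integrableD _ sf sg). Qed.

Lemma summB f g : summ f -> summ g -> summ (fun x => f x - g x).
Proof. by move=> sf sg; exact: (integrableB _ sf sg). Qed.

Lemma summZ c f : summ f -> summ (fun x => c * f x).
Proof. by move=> sf; exact: (integrableZl _ _ sf). Qed.

Lemma summ_norm f : summ f -> summ (fun x => `|f x|).
Proof. by move=> sf; exact: integrable_norm. Qed.

Lemma summ_lty f : (forall x, 0 <= f x) ->
  summ f <-> (\int[cnt]_x (f x)%:E < +oo)%E.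
Proof.
move=> f0; split => [/integrableP[_]|fy].
  by under eq_integral do rewrite /= ger0_norm//.
apply/integrableP; split => //.
by under eq_integral do rewrite /= ger0_norm//.
Qed.

Lemma EFin_sum f : summ f ->
  (\int[cnt]_x (f x)%:E)%E = (\int[cnt]_x f x)%:E.
Proof. by move=> sf; rewrite /Rintegral fineK//; exact: integrable_fin_num. Qed.

Lemma sumSD f g : summ f -> summ g ->
  \int[cnt]_x (f x + g x) = \int[cnt]_x f x + \int[cnt]_x g x.
Proof. by move=> sf sg; exact: RintegralD. Qed.

Lemma sumSB f g : summ f -> summ g ->
  \int[cnt]_x (f x - g x) = \int[cnt]_x f x - \int[cnt]_x g x.
Proof. by move=> sf sg; exact: RintegralB. Qed.

Lemma sumSZ c f : summ f -> \int[cnt]_x (c * f x) = c * \int[cnt]_x f x.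
Proof. by move=> sf; exact: RintegralZl. Qed.

Lemma ler_sumS f g : summ f -> summ g -> (forall x, f x <= g x) ->
  \int[cnt]_x f x <= \int[cnt]_x g x.
Proof. by move=> sf sg fg; exact: le_Rintegral. Qed.

Lemma norm_sumS f g : (forall x, `|f x| <= g x) -> summ g ->
  `|\int[cnt]_x f x| <= \int[cnt]_x g x.
Proof.
move=> fg sg; have sf := le_summ fg sg.
apply: (le_trans (le_normr_Rintegral _ sf)) => //.
by apply: ler_sumS => //; exact: summ_norm.
Qed.

(** Serves to split the diagonal term off a sum over all states. *)
Lemma summ_atom (y : X) c : summ (fun x => if x == y then c else 0) /\
  \int[cnt]_x (if x == y then c else 0) = c.
Proof.
have at0 (b : R) : 0 <= b ->
    (\int[cnt]_x (if x == y then b else 0)%:E)%E = b%:E.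
  move=> b0; rewrite (integral_counting_atom hX (x := y)) ?eqxx ?lee_fin//.
  by move=> x /negbTE ->.
have sat (b : R) : 0 <= b -> summ (fun x => if x == y then b else 0).
  by move=> b0; apply/summ_lty => [x|]; [case: ifP|rewrite at0 ?ltry].
have sc : summ (fun x => if x == y then c else 0).
  by apply: (le_summ _ (sat `|c| (normr_ge0 _))) => x; case: ifP; rewrite ?normr0.
split=> //; case: (lerP 0 c) => [c0|c0]; first by rewrite /Rintegral at0.
have E x : (if x == y then c else 0) = -1 * (if x == y then - c else 0).
  by case: ifP => _; lra.
under eq_Rintegral do rewrite E.
by rewrite sumSZ ?/Rintegral ?at0/=; [lra|lra|apply: sat; lra].
Qed.

Lemma term_le_sum f y : (forall x, 0 <= f x) -> summ f -> f y <= \int[cnt]_x f x.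
Proof.
move=> f0 sf; have [sa {1}<-] := summ_atom y (f y).
by apply: ler_sumS => // x; case: eqP => [->|].
Qed.

Lemma ge0_fubini_sum h : (forall x y, 0 <= h x y) -> (forall x, summ (h x)) ->
  summ (fun x => \int[cnt]_y h x y) ->
  [/\ forall y, summ (h ^~ y), summ (fun y => \int[cnt]_x h x y) &
      \int[cnt]_x \int[cnt]_y h x y = \int[cnt]_y \int[cnt]_x h x y].
Proof.
move=> h0 sh sS; have shy y : summ (h ^~ y).
  apply: (le_summ _ sS) => x; rewrite ger0_norm//.
  by apply: term_le_sum.
have eqS : (\int[cnt]_x (\int[cnt]_y h x y)%:E =
            \int[cnt]_y (\int[cnt]_x h x y)%:E)%E.
  under eq_integral do rewrite -EFin_sum//.
  under [RHS]eq_integral do rewrite -EFin_sum//.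
  by apply: tonelli_counting => // x y; rewrite lee_fin.
split; [exact: shy| |by rewrite /Rintegral eqS].
apply/summ_lty => [y|]; first by apply: Rintegral_ge0.
by rewrite -eqS (EFin_sum sS) ltry.
Qed.

(** The kernel [h] is the difference of the nonnegative kernels [|h| + h] and [|h|], to each of
    which the nonnegative case applies. *)
Lemma fubini_sum h : (forall x, summ (h x)) ->
  summ (fun x => \int[cnt]_y `|h x y|) ->
  [/\ forall y, summ (h ^~ y), summ (fun y => \int[cnt]_x h x y) &
      \int[cnt]_x \int[cnt]_y h x y = \int[cnt]_y \int[cnt]_x h x y].
Proof.
move=> sh sS; have snh x := summ_norm (sh x).
have [s1 s2 s3] := ge0_fubini_sum (fun x y => normr_ge0 (h x y)) snh sS.
pose u x y := `|h x y| + h x y.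
have u0 x y : 0 <= u x y by rewrite /u -lerBlDl sub0r lerNl -normrN ler_norm.
have su x : summ (u x) by exact: summD.
have sSh : summ (fun x => \int[cnt]_y h x y).
  by apply: (le_summ _ sS) => x; exact: norm_sumS.
have eu x : \int[cnt]_y u x y = \int[cnt]_y `|h x y| + \int[cnt]_y h x y.
  by rewrite /u sumSD.
have sSu : summ (fun x => \int[cnt]_y u x y).
  by under eq_fun do rewrite eu; exact: summD.
have [t1 t2 t3] := ge0_fubini_sum u0 su sSu.
have hE x y : h x y = u x y - `|h x y| by rewrite /u addrC addKr.
have shy y : summ (h ^~ y) by under eq_fun do rewrite hE; exact: summB.
have ey y : \int[cnt]_x h x y = \int[cnt]_x u x y - \int[cnt]_x `|h x y|.
  by under eq_Rintegral do rewrite hE; rewrite sumSB.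
split; [exact: shy|by rewrite (funext ey); exact: summB|].
rewrite [RHS](eq_Rintegral _ (fun y _ => ey y)) (sumSB t2 s2) -t3 -s3.
rewrite [X in _ = X - _](eq_Rintegral _ (fun x _ => eu x)) (sumSD sS sSh).
by rewrite addrC addKr.
Qed.

Lemma ge0_integral_density (mu : probability X R) (pi : X -> R) (g : X -> \bar R) :
  has_density mu pi -> (forall x, 0 <= g x)%E ->
  (\int[mu]_x g x = \int[cnt]_x (g x * (pi x)%:E))%E.
Proof.
move=> [pi0 hmu] g0.
have mu1 x : mu [set x] = (pi x)%:E.
  rewrite hmu integral_discrete_set1 ?lee_fin ?(ltW (pi0 _))//.
  by rewrite -[RHS]mule1 -(counting_set1 x).
rewrite (integral_countable_partition hX mu
  (F := fun x => [set x]) (g := g))//.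
- by apply: eq_integral => x _; rewrite -mu1.
- by move=> x; exact: discrete_measurable.
- by move=> x y w /= -> ->.
- by move=> x w /= ->.
- by move=> w /(_ w) /(_ erefl).
Qed.

(** Positive and negative parts are treated separately, and multiplication by [pi x >= 0] commutes
    with taking them, so the equality holds for every [g], integrable or not. *)
Lemma Rintegral_density (mu : probability X R) (pi g : X -> R) :
  has_density mu pi -> \int[mu]_x g x = \int[cnt]_x (g x * pi x).
Proof.
move=> hmu; have pi0 x := ltW (hmu.1 x).
rewrite /Rintegral; congr fine.
rewrite [LHS]integralE [RHS]integralE.
congr (_ - _)%E; rewrite (ge0_integral_density hmu)//; apply: eq_integral => x _.
  by rewrite !funeposE -!EFin_max -EFinM maxr_pMl// mul0r.
by rewrite !funenegE -!EFinN -!EFin_max -EFinM maxr_pMl// mul0r mulNr.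
Qed.

Lemma sum_dct (f : nat -> X -> R) f0 g : (forall n x, `|f n x| <= g x) ->
  summ g -> (forall x, f n x @[n --> \oo] --> f0 x) ->
  \int[cnt]_x f n x @[n --> \oo] --> \int[cnt]_x f0 x.
Proof.
move=> fg sg ff0.
have ff0E x : (f n x)%:E @[n --> \oo] --> (f0 x)%:E.
  by apply: cvg_EFin; [exact: nearW|exact: ff0].
have [sf0 _ cf] := @dominated_convergence _ _ _ cnt _ measurableT
  (fun n x => (f n x)%:E) (fun x => (f0 x)%:E) (EFin \o g) (fun n => mfun _)
  (mfun _) (aeW _ (fun x _ => ff0E x)) sg
  (aeW _ (fun x n _ => fg n x)).
rewrite /Rintegral; apply: fine_cvg; rewrite fineK; last exact: integrable_fin_num.
exact: cf.
Qed.

End Sums.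

(** * Weights and symmetry of the generator *)

Section Weights.
Context {R : realType} {d : measure_display} {X : measurableType d}.
Variable k : X -> X -> R.
Local Notation cnt := (@counting X R).

(* The diagonal is included, so the sum is [2 M_1(x)]. *)
Definition weight (x : X) : R := 1 + \int[cnt]_y `|k x y|.

Definition weight2 (x : X) : R := \int[cnt]_y (`|k x y| * (weight x + weight y)).

(** The form in which the moment hypotheses enter the entropy computation; [chain_tame_rates]
    derives it from [M1] and [M2]. *)
Record tame_rates (pi : X -> R) : Prop := TameRates {
  tame_rate : forall x, summ (k x);
  tame_rate_weight : forall x, summ (fun y => `|k x y| * weight y);
  tame_pi : forall x, 0 < pi x;
  tame_weight : summ (fun x => pi x * weight x ^+ 2);
  tame_weight2 : summ (fun x => pi x * weight2 x);
  tame_sym : detailed_balance k pi }.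

End Weights.

Section Calculus.
Context {R : realType} {d : measure_display} {X : measurableType d}.
Hypothesis hX : countable_discrete X.
Variables (k : X -> X -> R) (pi : X -> R).
Hypothesis tame : tame_rates k pi.
Local Notation cnt := (@counting X R).
Local Notation W := (weight k).
Local Notation V := (weight2 k).
Local Notation L := (generator k).
Implicit Types (a b f g : X -> R) (A B C : R).

Lemma weight_ge1 x : 1 <= W x.
Proof. by rewrite /weight lerDl; exact: Rintegral_ge0. Qed.

Lemma weight_gt0 x : 0 < W x.
Proof. exact: lt_le_trans (weight_ge1 x). Qed.

Lemma summ_kW x : summ (fun y => `|k x y| * (W x + W y)).
Proof.
under eq_fun do rewrite mulrDr mulrC.
apply: summD; last exact: (tame_rate_weight tame).
by apply: summZ; apply: summ_norm; exact: (tame_rate tame).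
Qed.

Lemma bounded_weight A a : (forall x, `|a x| <= A) -> forall x, `|a x| <= A * W x.
Proof.
move=> aA x; rewrite (le_trans (aA x))// ler_peMr ?weight_ge1//.
by rewrite (le_trans _ (aA x)).
Qed.

Lemma summ_generator B b x : (forall y, `|b y| <= B * W y) ->
  summ (fun y => k x y * (b y - b x)).
Proof.
move=> bB; apply: (le_summ hX _ (summZ B (summ_kW x))) => y.
rewrite normrM mulrCA ler_wpM2l// [W x + _]addrC mulrDr (le_trans (ler_normB _ _))//.
exact: lerD.
Qed.

Lemma generator_weight2 B b x : (forall y, `|b y| <= B * W y) ->
  `|L b x| <= B * V x.
Proof.
move=> bB; rewrite /weight2 -sumSZ; last exact: summ_kW.
apply: (norm_sumS hX); last by apply: summZ; exact: summ_kW.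
move=> y; rewrite normrM mulrCA ler_wpM2l// [W x + _]addrC mulrDr (le_trans (ler_normB _ _))//.
exact: lerD.
Qed.

Lemma generator_weight A a x : (forall y, `|a y| <= A) ->
  `|L a x| <= 2 * A * W x.
Proof.
move=> aA; have A0 : 0 <= A by apply: le_trans (aA x).
have sk := summ_norm (tame_rate tame x).
apply: (@le_trans _ _ (2 * A * \int[cnt]_y `|k x y|)); last first.
  by rewrite ler_wpM2l ?mulr_ge0// /weight lerDr.
rewrite -sumSZ//; apply: (norm_sumS hX); last exact: summZ.
move=> y; rewrite normrM mulrC ler_wpM2r// (le_trans (ler_normB _ _))//.
by rewrite mulr_natl mulr2n lerD.
Qed.

Lemma summ_pi_weight : summ (fun x => pi x * W x).
Proof.
apply: (le_summ hX _ (tame_weight tame)) => x.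
have p0 := ltW (tame_pi tame x); have w0 := ltW (weight_gt0 x).
rewrite ger0_norm ?mulr_ge0// ler_wpM2l// expr2 ler_peMl//.
exact: weight_ge1.
Qed.

(** Adding the kernel [pi x * k x y * a x * (b y - b x)] to its transpose gives, by detailed
    balance, minus the kernel of the bilinear form, and Fubini identifies the two double sums.
    Bounding the product [a x * (b y - b x)] as a whole covers both the case of bounded [a] with
    [b = O(W)] and the reverse one. *)
Lemma generator_by_parts B C a b :
  (forall x, `|b x| <= B * W x) ->
  (forall x y, `|a x * (b y - b x)| <= C * (W x + W y)) ->
  [/\ summ (fun x => pi x * (a x * L b x)),
      summ (fun x => pi x * \int[cnt]_y (k x y * ((a y - a x) * (b y - b x)))) &
      \int[cnt]_x (pi x * \int[cnt]_y (k x y * ((a y - a x) * (b y - b x)))) =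
      - 2 * \int[cnt]_x (pi x * (a x * L b x))].
Proof.
move=> bB abC.
pose h x y := pi x * (k x y * (a x * (b y - b x))).
have hle x y : `|h x y| <= C * (pi x * (`|k x y| * (W x + W y))).
  rewrite /h normrM (gtr0_norm (tame_pi tame x)) normrM [leRHS]mulrCA.
  rewrite ler_wpM2l ?(ltW (tame_pi tame x))// [leRHS]mulrCA.
  by rewrite ler_wpM2l.
have sdom x : summ (fun y => C * (pi x * (`|k x y| * (W x + W y)))).
  by do 2 apply: summZ; exact: summ_kW.
have sh x : summ (h x) by exact: (le_summ hX (hle x) (sdom x)).
(* Row [x] of [|h|] has mass at most [C * (pi x * V x)], which is summable by [tame_weight2]. *)
have snS : summ (fun x => \int[cnt]_y `|h x y|).
  apply: (le_summ hX _ (summZ C (tame_weight2 tame))) => x.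
  rewrite /weight2 -sumSZ; last exact: summ_kW.
  rewrite -sumSZ; last by apply: summZ; exact: summ_kW.
  by apply: (norm_sumS hX) => // y; rewrite normr_id.
have [sh' sS' SS] := fubini_sum hX sh snS.
have hE x : \int[cnt]_y h x y = pi x * (a x * L b x).
  have sg := summ_generator x bB.
  rewrite /h -sumSZ /generator//.
  rewrite -sumSZ/=; last exact: summZ.
  by apply: eq_Rintegral => y _; rewrite (mulrCA (a x)).
have sS : summ (fun x => \int[cnt]_y h x y).
  by apply: (le_summ hX _ snS) => x; apply: (norm_sumS hX) => //; exact: summ_norm.
have hh x y : h x y + h y x = - pi x * (k x y * ((a y - a x) * (b y - b x))).
  have -> : h y x = pi x * k x y * (a y * (b x - b y)).
    by rewrite /h mulrA (tame_sym tame x y).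
  by rewrite /h; ring.
have hhE x : pi x * \int[cnt]_y (k x y * ((a y - a x) * (b y - b x))) =
    - 1 * (\int[cnt]_y h x y + \int[cnt]_y h y x).
  rewrite -(sumSD (sh x) (sh' x)).
  under [in RHS]eq_Rintegral do rewrite hh.
  have sk : summ (fun y => k x y * ((a y - a x) * (b y - b x))).
    have -> : (fun y => k x y * ((a y - a x) * (b y - b x))) =
        (fun y => (- (pi x)^-1) * (h x y + h y x)).
      apply/funext => y; rewrite hh; field.
      by rewrite gt_eqF// (tame_pi tame).
    by apply: summZ; exact: summD.
  rewrite -(sumSZ (pi x) sk) -(sumSZ (- 1) (summZ (- pi x) sk)).
  by apply: eq_Rintegral => y _; ring.
have sSD := summZ (-1) (summD sS sS').
split.
- by under eq_fun do rewrite -hE.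
- by under eq_fun do rewrite hhE.
- rewrite (eq_Rintegral _ (fun x _ => hhE x)) (sumSZ (- 1) (summD sS sS')).
  rewrite (sumSD sS sS') -SS (eq_Rintegral _ (fun x _ => hE x)).
  by rewrite mulN1r mulNr mulr_natl mulr2n.
Qed.

Lemma bounded_mul_diff A B a b :
  (forall x, `|a x| <= A) -> (forall x, `|b x| <= B * W x) ->
  forall x y, `|a x * (b y - b x)| <= A * B * (W x + W y).
Proof.
move=> aA bB x y; have A0 : 0 <= A by apply: le_trans (aA x).
rewrite normrM -mulrA; apply: ler_pM => //.
by rewrite [W x + _]addrC mulrDr (le_trans (ler_normB _ _))// lerD.
Qed.

Lemma weight_mul_diff A B a b :
  (forall x, `|a x| <= A) -> (forall x, `|b x| <= B * W x) ->
  forall x y, `|b x * (a y - a x)| <= 2 * (A * B) * (W x + W y).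
Proof.
move=> aA bB x y; have A0 : 0 <= A by apply: le_trans (aA x).
have B0 : 0 <= B.
  by rewrite -(pmulr_lge0 _ (weight_gt0 x)); apply: le_trans (bB x).
rewrite normrM; apply: (@le_trans _ _ (B * W x * (2 * A))).
  apply: ler_pM => //; rewrite (le_trans (ler_normB _ _))//.
  by rewrite mulr_natl mulr2n lerD.
rewrite [leLHS](_ : _ = 2 * (A * B) * W x); last by ring.
by rewrite ler_wpM2l ?mulr_ge0// lerDl ltW ?weight_gt0.
Qed.

(** Multiplied by [-2], both sides become the same bilinear form, which is symmetric in [a] and
    [b]. *)
Lemma generator_sym A B a b :
  (forall x, `|a x| <= A) -> (forall x, `|b x| <= B * W x) ->
  \int[cnt]_x (pi x * (a x * L b x)) = \int[cnt]_x (pi x * (b x * L a x)).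
Proof.
move=> aA bB.
have [_ _ e1] := generator_by_parts bB (bounded_mul_diff aA bB).
have [_ _ e2] := generator_by_parts (bounded_weight aA) (weight_mul_diff aA bB).
apply: (@mulfI _ (- 2)); first by rewrite oppr_eq0 pnatr_eq0.
rewrite -e1 -e2; apply: eq_Rintegral => x _; congr (_ * _).
by apply: eq_Rintegral => y _; ring.
Qed.

End Calculus.

(** * Entropy production *)

Section PowerEntropy.
Context {R : realType}.
Variable p : R.
Hypothesis hp : 1 < p < 2.

(** [dPhi] and [ddPhi] are the closed forms of the first two derivatives of [Phi p] at positive
    arguments, where the densities take their values. *)
Definition dPhi (r : R) : R := (p * r `^ (p - 1) - 1) / (p * (p - 1)).

Definition ddPhi (r : R) : R := r `^ (p - 2).

Let pE : p != 0 /\ p - 1 != 0.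
Proof. by case/andP: hp => p1 p2; split; rewrite gt_eqF//; lra. Qed.

Lemma is_derive_Phi (r : R) : 0 < r -> is_derive r 1 (Phi p) (dPhi r).
Proof.
move=> r0; have dp := is_derive1_powR p r0.
rewrite [Phi p](_ : _ = (p * (p - 1))^-1 *: ((@powR R ^~ p) - id)); last first.
  by apply/funext => s; rewrite /Phi !fctE /= mulrC.
by apply: is_derive_eq; rewrite /dPhi /GRing.scale/= mulrC.
Qed.

Lemma is_derive_dPhi (r : R) : 0 < r -> is_derive r 1 dPhi (ddPhi r).
Proof.
move=> r0; have dp := is_derive1_powR (p - 1) r0; have [p0 p1] := pE.
rewrite [dPhi](_ : _ = (p * (p - 1))^-1 *: (p *: (@powR R ^~ (p - 1)) - cst 1)).
  apply: is_derive_eq; rewrite /ddPhi /GRing.scale/= subr0.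
  rewrite (_ : p - 1 - 1 = p - 2); last by ring.
  by field; rewrite p0 p1.
by apply/funext => s; rewrite /dPhi !fctE /= mulrC.
Qed.

Lemma derive1_Phi (r : R) : 0 < r -> (Phi p)^`()%classic r = dPhi r.
Proof. by move=> r0; have [_ <-] := is_derive_Phi r0; rewrite derive1E. Qed.

Lemma derive1_dPhi (r : R) : 0 < r -> ((Phi p)^`()^`())%classic r = ddPhi r.
Proof.
move=> r0; rewrite derive1E.
suff [_ ->] : is_derive r 1 (Phi p)^`()%classic (ddPhi r) by [].
apply: (@near_eq_is_derive _ _ _ dPhi); last exact: is_derive_dPhi.
near=> s; rewrite derive1_Phi//.
near: s; exact: lt_nbhsr.
Unshelve. all: by end_near. Qed.

Lemma mul_ddPhi (r : R) : 0 < r -> r * ddPhi r = (p - 1) * dPhi r + p^-1.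
Proof.
move=> r0; have [p0 p1] := pE; rewrite /ddPhi /dPhi.
have -> : r `^ (p - 1) = r * r `^ (p - 2).
  rewrite -[X in X * _](powRr1 (ltW r0)) -powRD; first by congr powR; ring.
  by apply/implyP => _; rewrite gt_eqF.
by field; rewrite p0.
Qed.

Lemma Phi_bounds (m M : R) : 0 < m -> exists C : R, forall r : R, m <= r <= M ->
  [/\ `|Phi p r| <= C, `|dPhi r| <= C & `|ddPhi r| <= C].
Proof.
move=> m0; case/andP: (hp) => p1 p2.
pose c := p * (p - 1); have c0 : 0 < c by rewrite mulr_gt0; lra.
(* Using [|M|] keeps the constants nonnegative without a sign assumption on [M]. *)
pose C1 := (`|M| `^ p + `|M|) / c; pose C2 := (p * `|M| `^ (p - 1) + 1) / c.
(* The exponent [p - 2] is negative, so [ddPhi r] is bounded by writing it as [r^(p - 1) / r] with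
   [r >= m]. *)
pose C3 := `|M| `^ (p - 1) / m.
have C10 : 0 <= C1 by rewrite divr_ge0 ?addr_ge0 ?powR_ge0// ltW.
have C20 : 0 <= C2.
  by rewrite divr_ge0 ?(ltW c0)// addr_ge0// mulr_ge0 ?powR_ge0//; lra.
have C30 : 0 <= C3 by rewrite divr_ge0 ?powR_ge0// ltW.
exists (C1 + C2 + C3) => r /andP[mr rM].
have r0 : 0 < r by lra.
have nM : r <= `|M| by rewrite (le_trans rM)// ler_norm.
have powM q : 0 <= q -> r `^ q <= `|M| `^ q.
  by move=> q0; apply: ge0_ler_powR => //; rewrite nnegrE// ltW.
split.
- apply: (@le_trans _ _ C1); last by lra.
  rewrite /Phi normrM [X in _ * X]gtr0_norm ?invr_gt0//.
  rewrite ler_pM2r ?invr_gt0// (le_trans (ler_normB _ _))// lerD//.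
    by rewrite ger0_norm ?powR_ge0// powM//; lra.
  by rewrite gtr0_norm.
- apply: (@le_trans _ _ C2); last by lra.
  rewrite /dPhi normrM [X in _ * X]gtr0_norm ?invr_gt0//.
  rewrite ler_pM2r ?invr_gt0// (le_trans (ler_normB _ _))// lerD// ?normr1//.
  rewrite normrM gtr0_norm; last by lra.
  by rewrite ger0_norm ?powR_ge0// ler_wpM2l ?powM//; lra.
- apply: (@le_trans _ _ C3); last by lra.
  rewrite ger0_norm ?powR_ge0// /C3 ler_pdivlMr//.
  apply: (@le_trans _ _ (r `^ (p - 2) * r)); first by rewrite ler_wpM2l ?powR_ge0.
  rewrite -[X in _ * X](powRr1 (ltW r0)) -powRD; last by apply/implyP => _; rewrite gt_eqF.
  by rewrite (_ : p - 2 + 1 = p - 1) ?powM//; lra.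
Qed.

End PowerEntropy.

Lemma derive1_Upsilon {R : realType} (r : R) : (@Upsilon R)^`()%classic r = expR r - 1.
Proof.
rewrite derive1E [@Upsilon R](_ : _ = expR - cst 1 - id).
  by rewrite derive_val subr0.
by apply/funext => s; rewrite /Upsilon !fctE.
Qed.

(** * Integrals of [Psi] and [Psi2] against a density with values in [[m, M]] *)

Section Production.
Context {R : realType} {d : measure_display} {X : measurableType d}.
Hypothesis hX : countable_discrete X.
Variables (k : X -> X -> R) (pi : X -> R) (p : R).
Hypothesis tame : tame_rates k pi.
Hypothesis hp : 1 < p < 2.
Local Notation cnt := (@counting X R).
Local Notation W := (weight k).
Local Notation V := (weight2 k).
Local Notation L := (generator k).
Variables (m M : R) (f : X -> R).
Hypothesis m0 : 0 < m.
Hypothesis fmM : forall x, m <= f x <= M.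
Local Notation psi := (dPhi p \o f).

Let f0 x : 0 < f x.
Proof. by case/andP: (fmM x) => /(lt_le_trans m0). Qed.

Let f_bound x : `|f x| <= M.
Proof. by rewrite gtr0_norm//; case/andP: (fmM x). Qed.

Lemma bounded_compositions : exists C : R, forall x,
  [/\ `|Phi p (f x)| <= C, `|dPhi p (f x)| <= C & `|ddPhi p (f x)| <= C].
Proof. by have [C hC] := Phi_bounds hp M m0; exists C => x; exact: hC. Qed.

(** [Lambda] is an increment of [Phi'] minus its tangent part; since [f] and [psi] are bounded, the
    two parts are separately summable against [k x]. *)
Lemma Psi_expand x : Psi k p f x = ddPhi p (f x) * L f x - L psi x.
Proof.
have [C hC] := bounded_compositions.
have sf := summ_generator hX tame x (bounded_weight k f_bound).
have spsi : summ (fun y => k x y * (psi y - psi x)).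
  by apply: (summ_generator hX tame x (B := C)); apply: bounded_weight => y; case: (hC y).
rewrite /Psi /generator -sumSZ// -sumSB//; last exact: summZ.
have sB := summB (summZ (ddPhi p (f x)) sf) spsi.
rewrite -mulN1r -sumSZ.
  apply: eq_Rintegral => y _.
  by rewrite /Lambda derive1_dPhi// !derive1_Phi//=; ring.
rewrite [X in summ X](_ : _ = (fun y => -1 * (ddPhi p (f x) * (k x y * (f y - f x)) - k x y * (psi y - psi x)))).
  exact: summZ.
by apply/funext => y; rewrite /Lambda derive1_dPhi// !derive1_Phi//=; ring.
Qed.

(** The factor [1] keeps every term in the shape [a * L b] handled by [generator_by_parts]. *)
Lemma mul_Psi x : f x * Psi k p f x =
  (p - 1) * (psi x * L f x) + p^-1 * (1 * L f x) - f x * L psi x.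
Proof.
have e := mul_ddPhi hp (f0 x).
transitivity (f x * ddPhi p (f x) * L f x - f x * L psi x).
  by rewrite Psi_expand; ring.
by rewrite e /=; ring.
Qed.

(** By symmetry [f * L psi] and [psi * L f] have the same integral, so the coefficient is
    [(p - 1) - 1 = -(2 - p)]; the term with [p^-1] integrates to zero. *)
Lemma sum_mul_Psi : summ (fun x => f x * Psi k p f x * pi x) /\
  \int[cnt]_x (f x * Psi k p f x * pi x) =
  - (2 - p) * \int[cnt]_x (pi x * (psi x * L f x)).
Proof.
have [C hC] := bounded_compositions.
have psiC x : `|psi x| <= C by case: (hC x).
have fW := bounded_weight k f_bound.
have psiW := bounded_weight k psiC.
have one1 (x : X) : `|cst (1 : R) x| <= 1 by rewrite /= normr1.
have [s1 _ _] := generator_by_parts hX tame fW (bounded_mul_diff psiC fW).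
have [s2 _ _] := generator_by_parts hX tame psiW (bounded_mul_diff f_bound psiW).
have [s3 _ e3] := generator_by_parts hX tame fW (bounded_mul_diff one1 fW).
(* Invariance of [pi]: the bilinear form vanishes when one argument is constant. *)
have L10 : \int[cnt]_x (pi x * (cst 1 x * L f x)) = 0.
  suff : - 2 * \int[cnt]_x (pi x * (cst 1 x * L f x)) = 0 by lra.
  rewrite -e3 /Rintegral integral0_eq// => x _.
  rewrite /Rintegral integral0_eq ?mulr0// => y _.
  by rewrite /= subrr mul0r mulr0.
have E x : f x * Psi k p f x * pi x = (p - 1) * (pi x * (psi x * L f x)) +
    p^-1 * (pi x * (cst 1 x * L f x)) - pi x * (f x * L psi x).
  by rewrite mul_Psi /=; ring.
have s13 := summD (summZ (p - 1) s1) (summZ p^-1 s3).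
split; first by rewrite (funext E); exact: summB.
rewrite (eq_Rintegral _ (fun x _ => E x)) sumSB// sumSD; [|exact: summZ..].
rewrite !sumSZ// L10 (generator_sym hX tame f_bound psiW) /=.
by ring.
Qed.

Lemma generator_derive1_Phi : generator k ((Phi p)^`()%classic \o f) = L psi.
Proof. by congr generator; apply/funext => x; rewrite /= derive1_Phi. Qed.

(** Here [Upsilon'(log f(y) - log f(x)) = f(y) / f(x) - 1], and the factor [f x] clears the
    denominator. *)
Lemma mul_B_Upsilon' g x :
  summ (fun y => k x y * ((f y - f x) * (g y - g x))) ->
  f x * B_Upsilon' k (@ln R \o f) g x =
  \int[cnt]_y (k x y * ((f y - f x) * (g y - g x))).
Proof.
move=> sfg; have fx0 := f0 x.
have E y : k x y * (@Upsilon R)^`()%classic ((@ln R \o f) y - (@ln R \o f) x) *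
    (g y - g x) = (f x)^-1 * (k x y * ((f y - f x) * (g y - g x))).
  rewrite derive1_Upsilon /= expRB !lnK ?posrE//.
  by field; rewrite gt_eqF.
rewrite /B_Upsilon'; under eq_Rintegral do rewrite E.
by rewrite sumSZ// mulrA divff ?mul1r// gt_eqF.
Qed.

Lemma Psi_weight : exists C : R, forall x, `|Psi k p f x| <= C * W x.
Proof.
have [C hC] := bounded_compositions.
exists (C * (2 * M) + 2 * C) => x.
have [_ h1 h2] := hC x; have C0 : 0 <= C by apply: le_trans h1.
have b1 := generator_weight hX tame x f_bound.
have b2 : `|L psi x| <= 2 * C * W x.
  by apply: (generator_weight hX tame) => y; case: (hC y).
rewrite Psi_expand mulrDl (le_trans (ler_normB _ _))// lerD//.
by rewrite normrM -mulrA ler_pM.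
Qed.

(* With [g = L (Phi' o f)], symmetry of [L] turns both [f L Psi] and the
   bilinear form of [f] and [g] into integrals of products of [L f], [g] and
   [Psi = Phi'' o f * L f - g]. *)
Lemma sum_mul_Psi2 : summ (fun x => f x * Psi2 k p f x * pi x) /\
  2 * \int[cnt]_x (f x * Psi2 k p f x * pi x) =
  \int[cnt]_x (pi x * (ddPhi p (f x) * L f x ^+ 2 + psi x * L (L f) x)).
Proof.
have [C hC] := bounded_compositions; have [D PsiD] := Psi_weight.
have psiC x : `|psi x| <= C by case: (hC x).
have fW := bounded_weight k f_bound.
have LfW x := generator_weight hX tame x f_bound.
have gW x := generator_weight hX tame x psiC.
pose g := L psi.
have [s1 _ _] := generator_by_parts hX tame PsiD (bounded_mul_diff f_bound PsiD).
have [s2 t2 e2] := generator_by_parts hX tame fW (weight_mul_diff f_bound gW).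
have [s3 _ _] := generator_by_parts hX tame LfW (bounded_mul_diff psiC LfW).
have [s4 _ _] := generator_by_parts hX tame fW (weight_mul_diff f_bound PsiD).
have sg x : summ (fun y => k x y * ((f y - f x) * (g y - g x))).
  apply: (le_summ hX _ (summZ (2 * M * (2 * C)) (summ_kW tame x))) => y.
  rewrite normrM [leRHS]mulrCA ler_wpM2l// normrM.
  rewrite -(mulrA (2 * M)) ler_pM//.
    rewrite (le_trans (ler_normB _ _))//.
    by rewrite mulr_natl mulr2n lerD.
  by rewrite [W x + _]addrC mulrDr (le_trans (ler_normB _ _))// lerD.
have half x : f x * Psi2 k p f x * pi x = 2^-1 * (pi x * (f x * L (Psi k p f) x)
    - pi x * \int[cnt]_y (k x y * ((g y - g x) * (f y - f x)))).
  transitivity (2^-1 * (pi x * (f x * L (Psi k p f) x) -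
      pi x * (f x * B_Upsilon' k (@ln R \o f) g x))).
    by rewrite /Psi2 generator_derive1_Phi -/g; ring.
  rewrite mul_B_Upsilon'//; congr (_ * (_ - _ * _)).
  by apply: eq_Rintegral => y _; rewrite [(f y - _) * _]mulrC.
split; first by rewrite (funext half); apply: summZ; exact: summB.
transitivity (\int[cnt]_x (pi x * (f x * L (Psi k p f) x)
    - pi x * \int[cnt]_y (k x y * ((g y - g x) * (f y - f x))))).
  under eq_Rintegral do rewrite half.
  by rewrite sumSZ; [lra|exact: summB].
rewrite sumSB// e2 (generator_sym hX tame f_bound PsiD).
rewrite mulNr opprK -sumSZ// -sumSD//; last exact: summZ.
(* Since [ddPhi p (f x) * L f x] is the sum of [Psi] and [g], this is the sum of two products
   already known to be summable. *)
have s5 : summ (fun x => pi x * (ddPhi p (f x) * L f x ^+ 2)).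
  rewrite (_ : (fun x => _) = (fun x => pi x * (Psi k p f x * L f x) +
      pi x * (g x * L f x))); first exact: summD.
  by apply/funext => x; rewrite Psi_expand /g; ring.
transitivity (\int[cnt]_x (pi x * (ddPhi p (f x) * L f x ^+ 2)
  + pi x * (g x * L f x))).
  by apply: eq_Rintegral => x _; rewrite Psi_expand /g; ring.
under [RHS]eq_Rintegral do rewrite mulrDr.
rewrite (sumSD s5 s2) (sumSD s5 s3); congr (_ + _).
(* A last use of symmetry moves the outer generator of [psi * L (L f)] onto [psi], producing
   [g * L f]. *)
rewrite (generator_sym hX tame psiC LfW).
by apply: eq_Rintegral => x _; rewrite /g; ring.
Qed.

End Production.

(** * The backward equation *)

Lemma norm_le_bounds {R : realDomainType} (m M a : R) :
  m <= a <= M -> `|a| <= `|m| + `|M|.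
Proof.
move=> /andP[ma aM]; rewrite ler_norml; apply/andP; split.
  by rewrite (le_trans _ ma)// opprD lerBlDr ler_wpDr// lerNl -normrN ler_norm.
by rewrite (le_trans aM)// ler_wpDl// ler_norm.
Qed.

Lemma eq_cvgn {R : realType} (u v : R^nat) (l : R) :
  u =1 v -> u @ \oo --> l -> v @ \oo --> l.
Proof. by move=> /funext ->. Qed.

Section TransitionFunction.
Context {R : realType} {d : measure_display} {X : measurableType d}.
Hypothesis hX : countable_discrete X.
Local Notation cnt := (@counting X R).

(* Pratt's form of dominated convergence: the dominating masses converge
   instead of being constant. *)
Lemma scheffe_sum (a : nat -> X -> R) (a0 : X -> R) (g : nat -> X -> R)
    (g0 : X -> R) (C : R) :
  (forall n x, 0 <= a n x) -> (forall x, 0 <= a0 x) ->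
  (forall n, summ (a n)) -> summ a0 ->
  (forall x, a n x @[n --> \oo] --> a0 x) ->
  \int[cnt]_x a n x @[n --> \oo] --> \int[cnt]_x a0 x ->
  (forall n x, `|g n x| <= C) -> (forall x, g n x @[n --> \oo] --> g0 x) ->
  \int[cnt]_x (a n x * g n x) @[n --> \oo] --> \int[cnt]_x (a0 x * g0 x).
Proof.
move=> age0 a0ge0 sa sa0 aa0 SaSa0 gC gg0.
have g0C x : `|g0 x| <= C.
  have : `|g n x| @[n --> \oo] --> `|g0 x| by apply: cvg_norm; exact: gg0.
  by move=> /cvgr_to_le; apply; apply: nearW => n; exact: gC.
(* [r n] is the positive part of [a0 - a n]. It is dominated by the fixed function [a0], and
   [|a0 - a n| = a n - a0 + 2 * r n], so convergence of the total masses upgrades to convergence in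
   the sum norm. *)
pose r n x := 2^-1 * (`|a0 x - a n x| + (a0 x - a n x)).
have r_le n x : `|r n x| <= a0 x.
  have := age0 n x; have := a0ge0 x; rewrite /r.
  case: (lerP 0 (a0 x - a n x)) => h ? ?.
    by rewrite (ger0_norm h) ger0_norm; lra.
  by rewrite (ltr0_norm h) addNr mulr0 normr0.
have cr : \int[cnt]_x r n x @[n --> \oo] --> (0 : R).
  have -> : 0 = \int[cnt]_x (0 : R) :> R by rewrite /Rintegral integral0.
  apply: (sum_dct hX (g := a0)) => // x.
  have cd : a0 x - a n x @[n --> \oo] --> a0 x - a0 x.
    by apply: cvgB; [exact: cvg_cst|exact: aa0].
  rewrite subrr in cd.
  rewrite (_ : (0 : R) = 2^-1 * (`|(0 : R)| + 0)); last by rewrite normr0; ring.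
  by apply: cvgMr; apply: cvgD => //; exact: cvg_norm.
have ce : \int[cnt]_x (a0 x * `|g n x - g0 x|) @[n --> \oo] --> (0 : R).
  have -> : 0 = \int[cnt]_x (0 : R) :> R by rewrite /Rintegral integral0.
  apply: (sum_dct hX (g := fun x => 2 * C * a0 x)).
  - move=> n x; rewrite normrM (ger0_norm (a0ge0 x)) normr_id mulrC ler_wpM2r//.
    by rewrite (le_trans (ler_normB _ _))// mulr_natl mulr2n lerD.
  - exact: summZ.
  - move=> x; rewrite -(mulr0 (a0 x)); apply: cvgMr.
    rewrite -(@normr0 _ R); apply: cvg_norm.
    by apply/subr_cvg0; exact: gg0.
have sr n : summ (r n) by exact: (le_summ hX (r_le n)).
have sag n : summ (fun x => a n x * g n x).
  apply: (le_summ hX _ (summZ C (sa n))) => x.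
  by rewrite normrM mulrC (ger0_norm (age0 n x)) ler_wpM2r.
have sag0 : summ (fun x => a0 x * g0 x).
  apply: (le_summ hX _ (summZ C sa0)) => x.
  by rewrite normrM mulrC (ger0_norm (a0ge0 _)) ler_wpM2r.
have se n : summ (fun x => a0 x * `|g n x - g0 x|).
  apply: (le_summ hX _ (summZ (2 * C) sa0)) => x.
  rewrite normrM (ger0_norm (a0ge0 x)) normr_id mulrC ler_wpM2r//.
  by rewrite (le_trans (ler_normB _ _))// mulr_natl mulr2n lerD.
apply/subr_cvg0; apply: norm_cvg0.
(* The error is split as [(a n - a0) * g n + a0 * (g n - g0)], whose two parts are bounded by the
   two terms here. *)
pose bnd n := C * (\int[cnt]_x a n x - \int[cnt]_x a0 x + 2 * \int[cnt]_x r n x) +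
  \int[cnt]_x (a0 x * `|g n x - g0 x|).
have cb : bnd n @[n --> \oo] --> (0 : R).
  rewrite (_ : (0 : R) = C * (\int[cnt]_x a0 x - \int[cnt]_x a0 x + 2 * 0) + 0); last by ring.
  apply: cvgD => //; apply: cvgMr; apply: cvgD; last exact: cvgMr.
  by apply: cvgB => //; exact: cvg_cst.
apply: (squeeze_cvgr _ (cvg_cst 0) cb); apply: nearW => n.
rewrite normr_ge0/= -sumSB//.
have sd := summD (summB (sa n) sa0) (summZ 2 (sr n)).
have -> : bnd n = \int[cnt]_x (C * (a n x - a0 x + 2 * r n x) + a0 x * `|g n x - g0 x|).
  rewrite sumSD//; last exact: summZ.
  rewrite sumSZ// sumSD//; [|exact: summB|exact: summZ].
  by rewrite sumSB// sumSZ.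
apply: (norm_sumS hX); last by apply: summD => //; exact: summZ.
move=> x.
have -> : a n x * g n x - a0 x * g0 x = (a n x - a0 x) * g n x + a0 x * (g n x - g0 x).
  by ring.
rewrite (le_trans (ler_normD _ _))// lerD//.
  rewrite normrM mulrC distrC (_ : a n x - a0 x + _ = `|a0 x - a n x|).
    by rewrite ler_wpM2r.
  by rewrite /r; field.
by rewrite normrM ger0_norm.
Qed.

(** Isolates the analytic data of the chain, so that the backward equation is proved without
    reference to paths. *)
Record transition_function (k : X -> X -> R) (P : R -> X -> X -> R) : Prop :=
  TransitionFunction {
  tf_ge0 : forall (t : R) x y, 0 <= t -> 0 <= P t x y;
  tf_summ : forall (t : R) x, 0 <= t -> summ (P t x);
  tf_sum : forall (t : R) x, 0 <= t -> \int[cnt]_y P t x y = 1;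
  tf_add : forall (s t : R) x z, 0 <= s -> 0 <= t ->
    P (s + t) x z = \int[cnt]_y (P s x y * P t y z);
  tf_rates : forall x y, (P t x y - (x == y)%:R) / t @[t --> 0^'+] --> k x y;
  tf_offdiag : forall x y, x != y -> 0 <= k x y;
  tf_summ_rates : forall x, summ (k x);
  tf_conservative : forall x, \int[cnt]_y k x y = 0 }.

Variables (k : X -> X -> R) (P : R -> X -> X -> R).
Hypothesis tf : transition_function k P.
Local Notation L := (generator k).

(** Off the diagonal [P_h(x,.) / h] has mass [(1 - P_h(x,x)) / h], which tends to [- k x x], the
    off-diagonal mass of [k x]; this is the mass convergence required by [scheffe_sum]. The function
    [g n] may vary with [n], as the left derivative demands. *)
Lemma diffquot_cvg (h : nat -> R) (g : nat -> X -> R) (g0 : X -> R) (C : R) x :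
  (forall n, 0 < h n) -> h n @[n --> \oo] --> 0 ->
  (forall n y, `|g n y| <= C) -> (forall y, g n y @[n --> \oo] --> g0 y) ->
  (\int[cnt]_y (P (h n) x y * g n y) - g n x) / h n @[n --> \oo] --> L g0 x.
Proof.
move=> h0 hcvg gC gg0; have h0' n := ltW (h0 n).
have ratecvg y : (P (h n) x y - (x == y)%:R) / h n @[n --> \oo] --> k x y.
  by have /cvg_at_rightP := @tf_rates _ _ tf x y; apply.
(* The diagonal entry, which would diverge, is set to zero; this changes nothing because the factor
   [g n y - g n x] vanishes there. *)
pose a n y := if y == x then 0 else P (h n) x y / h n.
pose a0 y := if y == x then 0 else k x y.
have aE n y : a n y = (h n)^-1 * (P (h n) x y - (if y == x then P (h n) x x else 0)).
  by rewrite /a; case: eqP => [->|_]; ring.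
have a0E y : a0 y = k x y - (if y == x then k x x else 0).
  by rewrite /a0; case: eqP => [->|_]; ring.
have sP n : summ (P (h n) x) by exact: (tf_summ tf).
have sk := tf_summ_rates tf x.
have Sa n : summ (a n) /\ \int[cnt]_y a n y = - ((P (h n) x x - (x == x)%:R) / h n).
  have [s1 e1] := summ_atom hX x (P (h n) x x).
  split; first by rewrite (funext (aE n)); apply: summZ; exact: summB.
  under eq_Rintegral do rewrite aE.
  rewrite sumSZ ?sumSB// ?e1 ?(tf_sum tf)//; last exact: summB.
  by rewrite eqxx /=; field; rewrite gt_eqF.
have Sa0 : summ a0 /\ \int[cnt]_y a0 y = - k x x.
  have [s1 e1] := summ_atom hX x (k x x).
  split; first by rewrite (funext a0E); exact: summB.
  under eq_Rintegral do rewrite a0E.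
  by rewrite sumSB// e1 (tf_conservative tf) sub0r.
have -> : L g0 x = \int[cnt]_y (a0 y * (g0 y - g0 x)).
  apply: eq_Rintegral => y _; rewrite /a0; case: eqP => [->|//].
  by rewrite subrr !mulr0.
have -> : (fun n => (\int[cnt]_y (P (h n) x y * g n y) - g n x) / h n) =
    (fun n => \int[cnt]_y (a n y * (g n y - g n x))).
  apply/funext => n.
  have sPg : summ (fun y => P (h n) x y * g n y).
    apply: (le_summ hX _ (summZ C (sP n))) => y.
    have Pge0 := tf_ge0 tf x y (h0' n).
    by rewrite normrM mulrC (ger0_norm Pge0) ler_wpM2r.
  transitivity ((h n)^-1 * (\int[cnt]_y (P (h n) x y * g n y - g n x * P (h n) x y))).
    by rewrite sumSB ?sumSZ ?(tf_sum tf)//; [rewrite mulr1 mulrC|exact: summZ].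
  rewrite -sumSZ; last by apply: summB => //; exact: summZ.
  apply: eq_Rintegral => y _; rewrite /a; case: eqP => [->|_]; last by ring.
  by rewrite mul0r mulrC (mulrC (g n x)) subrr mul0r.
apply: (@scheffe_sum _ _ _ _ (2 * C)).
- move=> n y; rewrite /a; case: ifP => // _.
  by rewrite divr_ge0// (tf_ge0 tf).
- move=> y; rewrite /a0; case: eqP => // /eqP yx; apply: (tf_offdiag tf).
  by rewrite eq_sym.
- by move=> n; case: (Sa n).
- by case: Sa0.
- move=> y; rewrite /a /a0; case: eqP => [_|/eqP yx]; first exact: cvg_cst.
  have := ratecvg y; rewrite eq_sym (negbTE yx).
  by under eq_fun do rewrite subr0.
- case: Sa0 => _ ->; under eq_fun do rewrite (Sa _).2.
  by apply: cvgN; exact: ratecvg.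
- move=> n y; rewrite (le_trans (ler_normB _ _))//.
  by rewrite mulr_natl mulr2n lerD.
- by move=> y; apply: cvgB; exact: gg0.
Qed.

Variables (f : X -> R) (m M : R).
Hypothesis fmM : forall x, m <= f x <= M.

Definition evolve (t : R) (x : X) : R := \int[cnt]_y (P t x y * f y).

Let C : R := `|m| + `|M|.

Let summ_evolve (t : R) x : 0 <= t -> summ (fun y => P t x y * f y).
Proof.
move=> t0; apply: (le_summ hX _ (summZ C (tf_summ tf x t0))) => y.
have Pge0 := tf_ge0 tf x y t0.
by rewrite normrM mulrC (ger0_norm Pge0) ler_wpM2r// norm_le_bounds.
Qed.

Lemma evolve_bounds (t : R) x : 0 <= t -> m <= evolve t x <= M.
Proof.
move=> t0; have sP := tf_summ tf x t0; have P1 := tf_sum tf x t0.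
have sE := summ_evolve x t0.
have le_f (u v : X -> R) : (forall y, u y <= v y) ->
    forall y, P t x y * u y <= P t x y * v y.
  by move=> uv y; rewrite ler_wpM2l ?(tf_ge0 tf).
have sc (c : R) : summ (fun y => P t x y * c).
  by under eq_fun do rewrite mulrC; exact: summZ.
have cE (c : R) : c = \int[cnt]_y (P t x y * c).
  by under eq_Rintegral do rewrite mulrC; rewrite sumSZ// P1 mulr1.
rewrite [X in X <= _ <= _]cE [X in _ <= _ <= X]cE; apply/andP.
by split; apply: ler_sumS => //; apply: le_f => y; case/andP: (fmM y).
Qed.

Lemma evolve_add (s t : R) x : 0 <= s -> 0 <= t ->
  evolve (s + t) x = \int[cnt]_y (P s x y * evolve t y).
Proof.
move=> s0 t0; pose h y z := P s x y * (P t y z * f z).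
have sh y : summ (h y) by apply: summZ; exact: summ_evolve.
have fC y : `|f y| <= C.
  exact: norm_le_bounds.
have shS : summ (fun y => \int[cnt]_z `|h y z|).
  apply: (le_summ hX _ (summZ C (tf_summ tf x s0))) => y.
  rewrite ger0_norm; last exact: Rintegral_ge0.
  have -> : C * P s x y = \int[cnt]_z (C * P s x y * P t y z).
    by rewrite sumSZ ?(tf_sum tf) ?mulr1//; exact: (tf_summ tf).
  apply: ler_sumS; [exact: summ_norm|by apply: summZ; exact: (tf_summ tf)|].
  move=> z; rewrite /h !normrM !(ger0_norm (tf_ge0 tf _ _ _))//.
  by rewrite mulrA mulrC mulrA ler_wpM2r ?(tf_ge0 tf)// ler_wpM2r ?(tf_ge0 tf).
have [_ _ e] := fubini_sum hX sh shS.
transitivity (\int[cnt]_y \int[cnt]_z h y z); last first.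
  by apply: eq_Rintegral => y _; rewrite /h sumSZ//; exact: summ_evolve.
rewrite e; apply: eq_Rintegral => z _.
rewrite (tf_add tf)// mulrC -sumSZ.
  by apply: eq_Rintegral => y _; rewrite /h; ring.
have sPs : summ (fun y => C * P s x y) by apply: summZ; exact: (tf_summ tf).
apply: (le_summ hX _ (tf_summ tf x s0)) => y.
rewrite normrM !ger0_norm ?(tf_ge0 tf)// ler_piMr ?(tf_ge0 tf)//.
rewrite -(tf_sum tf y t0); apply: (term_le_sum hX); last exact: (tf_summ tf).
by move=> ?; exact: (tf_ge0 tf).
Qed.

(** The difference is the average under [P_h(x,.)] of [g y - g x] with [g = evolve (t - h)]. Only
    [y != x] contributes, so it is at most [2 * C * (1 - P_h(x,x))], which tends to zero because its
    quotient by [h] converges. *)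
Lemma evolve_left_cvg (h : nat -> R) (t : R) x : (forall n, 0 < h n < t) ->
  h n @[n --> \oo] --> 0 -> evolve (t - h n) x @[n --> \oo] --> evolve t x.
Proof.
move=> h0t hcvg; have h0 n : 0 < h n by case/andP: (h0t n).
have th0 n : 0 <= t - h n by case/andP: (h0t n) => _ /ltW; rewrite subr_ge0.
have evC (s : R) y : 0 <= s -> `|evolve s y| <= C.
  by move=> s0; apply: norm_le_bounds; exact: evolve_bounds.
have cP : 2 * C * (1 - P (h n) x x) @[n --> \oo] --> (0 : R).
  have /cvg_at_rightP/(_ h) := @tf_rates _ _ tf x x; rewrite eqxx => /(_ (conj h0 hcvg)) cq.
  have -> : (fun n => 2 * C * (1 - P (h n) x x)) =
      (fun n => - (2 * C) * (((P (h n) x x - 1) / h n) * h n)).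
    by apply/funext => n; field; rewrite gt_eqF.
  rewrite (_ : (0 : R) = - (2 * C) * (k x x * 0)); last by ring.
  by apply: cvgMr; exact: cvgM.
have PE n : 0 <= 1 - P (h n) x x.
  rewrite subr_ge0 -(tf_sum tf x (ltW (h0 n))); apply: (term_le_sum hX).
    by move=> y; exact: (tf_ge0 tf _ _ (ltW (h0 n))).
  exact: (tf_summ tf _ (ltW (h0 n))).
apply/cvgrPdist_le => e e0; have /cvgrPdist_le/(_ e e0) := cP.
apply: filterS => n; rewrite sub0r normrN; apply: le_trans.
have hn0 := ltW (h0 n); have sP := tf_summ tf x hn0.
have -> : evolve t x = \int[cnt]_y (P (h n) x y * evolve (t - h n) y).
  by rewrite -evolve_add//; congr evolve; ring.
set g := evolve (t - h n).
have gC y : `|g y| <= C by exact: evC.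
have sPg : summ (fun y => P (h n) x y * g y).
  apply: (le_summ hX _ (summZ C sP)) => y; have Pge0 := tf_ge0 tf x y hn0.
  by rewrite normrM mulrC (ger0_norm Pge0) ler_wpM2r.
have -> : \int[cnt]_y (P (h n) x y * g y) - g x =
    \int[cnt]_y (P (h n) x y * g y - g x * P (h n) x y).
  by rewrite sumSB// ?sumSZ ?(tf_sum tf) ?mulr1//; exact: summZ.
have [sa ea] := summ_atom hX x (P (h n) x x).
apply: (le_trans _ (ler_norm _)).
have -> : 1 - P (h n) x x =
    \int[cnt]_y (P (h n) x y - if y == x then P (h n) x x else 0).
  by rewrite sumSB// (tf_sum tf)// ea.
rewrite -sumSZ; last exact: summB.
apply: (norm_sumS hX); last by apply: summZ; exact: summB.
move=> y; rewrite (mulrC (g x)) -mulrBr; case: eqP => [->|_].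
  by rewrite !subrr !mulr0 normr0.
have Pge0 := tf_ge0 tf x y hn0.
rewrite subr0 normrM mulrC (ger0_norm Pge0) ler_wpM2r//.
by rewrite (le_trans (ler_normB _ _))// (le_trans (lerD (gC y) (gC x)))//; lra.
Qed.

(** Both one-sided difference quotients have the form [(P_h g - g) / h], with [g = evolve t] on the
    right and the moving [g = evolve (t - h)] on the left. *)
Lemma is_derive_evolve (t : R) x : 0 < t ->
  is_derive t 1 (evolve ^~ x) (L (evolve t) x).
Proof.
move=> t0.
have evC (s : R) y : 0 <= s -> `|evolve s y| <= C.
  by move=> s0; apply: norm_le_bounds; exact: evolve_bounds.
suff cvgq : h^-1 *: (evolve (h *: 1 + t) x - evolve t x) @[h --> 0^'] --> L (evolve t) x.
  by apply: DeriveDef; [apply/cvg_ex; exists (L (evolve t) x)|exact/cvg_lim].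
apply: (@cvg_at_right_left_dnbhs _ R^o).
  apply/cvg_at_rightP => h [h0 hcvg].
  have hd : (\int[cnt]_y (P (h n) x y * evolve t y) - evolve t x) / h n
      @[n --> \oo] --> L (evolve t) x.
    apply: (@diffquot_cvg h (fun=> evolve t) _ C x h0 hcvg) => [_ y|y].
      exact: evC _ _ (ltW t0).
    exact: cvg_cst.
  apply: (eq_cvgn _ hd) => n /=.
  rewrite -evolve_add ?(ltW t0) ?(ltW (h0 n))//.
  by rewrite /GRing.scale/= mulr1 mulrC.
apply/cvg_at_leftP => h [h0 hcvg].
have hNcvg : - h n @[n --> \oo] --> (0 : R) by rewrite -[0]oppr0; exact: cvgN.
have /cvgrPdist_lt/(_ t t0)[N _ hN] := hNcvg.
(* Dropping the first [N] terms ensures that the time [t - h' n] stays nonnegative. *)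
rewrite -(cvg_shiftn N).
pose h' n := - h (n + N)%N.
have h't n : 0 < h' n < t.
  rewrite oppr_gt0 h0/=; have := hN (n + N)%N (leq_addl _ _).
  by rewrite sub0r normrN; apply: le_lt_trans; exact: ler_norm.
have h'cvg : h' n @[n --> \oo] --> (0 : R).
  by rewrite /h' (cvg_shiftn N (fun n => - h n)).
have h'0 n : 0 < h' n by case/andP: (h't n).
have th' n : 0 <= t - h' n by case/andP: (h't n) => _ /ltW; rewrite subr_ge0.
have hd : (\int[cnt]_y (P (h' n) x y * evolve (t - h' n) y) - evolve (t - h' n) x) / h' n
    @[n --> \oo] --> L (evolve t) x.
  apply: (@diffquot_cvg h' (fun n => evolve (t - h' n)) _ C x h'0 h'cvg) => [n y|y].
    exact: evC.
  exact: evolve_left_cvg.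
apply: (eq_cvgn _ hd) => n /=.
rewrite -evolve_add ?(ltW (h'0 n))//.
have -> : h' n + (t - h' n) = t by ring.
have -> : (h (n + N)%N)%:A + t = t - h' n.
  by rewrite /h' /GRing.scale/= mulr1 opprK addrC.
have -> : h (n + N)%N = - h' n by rewrite /h' opprK.
by rewrite /GRing.scale /= [(- h' n)^-1]invrN mulNr -mulrN opprB mulrC.
Qed.

End TransitionFunction.

(** * Time derivatives of the entropy *)

Section DerivativeUnderSum.
Context {R : realType} {d : measure_display} {X : measurableType d}.
Hypothesis hX : countable_discrete X.
Local Notation cnt := (@counting X R).

Lemma is_derive_sum (F F' : R -> X -> R) (G : X -> R) (t : R) : 0 < t ->
  (forall s : R, 0 < s -> summ (F s)) ->
  (forall (s : R) x, 0 < s -> is_derive s 1 (F ^~ x) (F' s x)) ->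
  (forall (s : R) x, 0 < s -> `|F' s x| <= G x) -> summ G ->
  is_derive t 1 (fun s => \int[cnt]_x F s x) (\int[cnt]_x F' t x).
Proof.
move=> t0 sF dF FG sG.
(* The domination holds at all positive times, so any open interval of positive times around [t]
   would serve. *)
have I0 s : s \in `]0, (t + 1)%R[%R -> 0 < s by rewrite in_itv/= => /andP[].
have It : [set` `]0, (t + 1)%R[%R] t by rewrite /= in_itv/= t0 ltrDl ltr01.
have dF1 (s : R) x : 0 < s -> partial1of2 F s x = F' s x.
  by move=> s0; rewrite partial1of2E; have [_ ->] := dF s x s0.
have hc : h^-1 *: (\int[cnt]_x F (h + t) x - \int[cnt]_x F t x) @[h --> 0^']
    --> \int[cnt]_x F' t x.
  have -> : \int[cnt]_x F' t x = \int[cnt]_x partial1of2 F t x.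
    by apply: eq_Rintegral => x _; rewrite dF1.
  apply: (@cvg_differentiation_under_integral _ _ _ _ _ _ measurableT _ _ _ It _ _ G) => //.
  - by move=> s /I0 s0; exact: sF.
  - by move=> s x /I0 s0 _; have [] := dF s x s0.
  - by move=> x; apply: le_trans (FG t x t0).
  - by move=> s x /I0 s0 _; rewrite dF1//; exact: FG.
have hc' : h^-1 *: (\int[cnt]_x F (h *: 1 + t) x - \int[cnt]_x F t x) @[h --> 0^']
    --> \int[cnt]_x F' t x.
  by under eq_fun do rewrite scaler1.
by apply: DeriveDef; [apply/cvg_ex; eexists; exact: hc'|exact/cvg_lim].
Qed.

Variables (k : X -> X -> R) (P : R -> X -> X -> R) (pi f : X -> R) (p m M : R).
Hypothesis tf : transition_function k P.
Hypothesis tame : tame_rates k pi.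
Hypothesis hp : 1 < p < 2.
Hypothesis m0 : 0 < m.
Hypothesis fmM : forall x, m <= f x <= M.
Local Notation L := (generator k).
Local Notation W := (weight k).
Local Notation V := (weight2 k).
Local Notation u := (evolve P f).

Let umM (s : R) x : 0 < s -> m <= u s x <= M.
Proof. by move=> s0; apply: (evolve_bounds hX tf fmM); exact: ltW. Qed.

Let u0 (s : R) x : 0 < s -> 0 < u s x.
Proof. by move=> /(umM x)/andP[/(lt_le_trans m0)]. Qed.

Let u_bound (s : R) x : 0 < s -> `|u s x| <= M.
Proof. by move=> s0; rewrite gtr0_norm ?u0//; case/andP: (umM x s0). Qed.

Let du (s : R) x : 0 < s -> is_derive s 1 (u ^~ x) (L (u s) x).
Proof. by move=> s0; exact: (is_derive_evolve hX tf fmM). Qed.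

(** Since [L (u s)] is at most [2 * M * W] uniformly in [s], the differentiated terms are dominated
    by a multiple of [|k x y| * (W x + W y)]. *)
Lemma is_derive_generator_evolve (t : R) x : 0 < t ->
  is_derive t 1 (fun s => L (u s) x) (L (L (u t)) x).
Proof.
move=> t0; apply: (@is_derive_sum (fun s y => k x y * (u s y - u s x))
  (fun s y => k x y * (L (u s) y - L (u s) x))
  (fun y => 2 * M * (`|k x y| * (W x + W y)))) => //.
- move=> s s0; apply: (summ_generator hX tame x (B := M)).
  by apply: bounded_weight => y; exact: u_bound.
- move=> s y s0; have d1 := du y s0; have d2 := du x s0.
  rewrite (_ : (fun s => _) = k x y *: ((u ^~ y) - (u ^~ x))).
    exact: is_derive_eq.
  by apply/funext => r; rewrite !fctE.
- move=> s y s0; rewrite normrM [leRHS]mulrCA ler_wpM2l//.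
  rewrite [W x + _]addrC mulrDr (le_trans (ler_normB _ _))// lerD//;
  by apply: (generator_weight hX tame) => z; exact: u_bound.
- by apply: summZ; exact: (summ_kW tame).
Qed.

(** The evolution stays in [[m, M]], so the dominating functions do not depend on time: a multiple
    of [pi * W] for the first derivative, and multiples of [pi * W^2] and [pi * V] for the
    second. *)
Lemma entropy_derivatives (t : R) : 0 < t ->
  is_derive t 1 (fun s => \int[cnt]_x (Phi p (u s x) * pi x))
    (\int[cnt]_x (pi x * (dPhi p (u t x) * L (u t) x))) /\
  is_derive t 1 (fun s => \int[cnt]_x (pi x * (dPhi p (u s x) * L (u s) x)))
    (\int[cnt]_x (pi x * (ddPhi p (u t x) * L (u t) x ^+ 2 +
                          dPhi p (u t x) * L (L (u t)) x))).
Proof.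
move=> t0; have [C hC] := Phi_bounds hp M m0.
have LW (s : R) x : 0 < s -> `|L (u s) x| <= 2 * M * W x.
  by move=> s0; apply: (generator_weight hX tame) => y; exact: u_bound.
have pi0 x := tame_pi tame x.
have dW (s : R) x : 0 < s -> `|pi x * (dPhi p (u s x) * L (u s) x)| <=
    C * (2 * M) * (pi x * W x).
  move=> s0; have [_ h2 _] := hC _ (umM x s0).
  rewrite normrM (gtr0_norm (pi0 x)) [leRHS]mulrCA ler_wpM2l ?(ltW (pi0 x))//.
  by rewrite normrM -mulrA ler_pM// LW.
split.
- apply: (@is_derive_sum (fun s x => Phi p (u s x) * pi x)
    (fun s x => pi x * (dPhi p (u s x) * L (u s) x)) _ _ t0 _ _ dW).
  + move=> s s0; apply: (le_summ hX _ (summZ C (summ_pi_weight hX tame))) => x.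
    have [h1 _ _] := hC _ (umM x s0).
    rewrite normrM (gtr0_norm (pi0 x)) [leRHS]mulrCA mulrC ler_wpM2l ?(ltW (pi0 x))//.
    by rewrite (le_trans h1)// ler_peMr ?weight_ge1// (le_trans _ h1).
  + move=> s x s0; have d1 := du x s0; have d2 := is_derive_Phi p (u0 x s0).
    rewrite (_ : (fun s => _) = pi x *: (Phi p \o (u ^~ x))).
      exact: is_derive_eq.
    by apply/funext => r; rewrite !fctE /GRing.scale/= mulrC.
  + by apply: summZ; exact: (summ_pi_weight hX tame).
apply: (@is_derive_sum (fun s x => pi x * (dPhi p (u s x) * L (u s) x))
  (fun s x => pi x * (ddPhi p (u s x) * L (u s) x ^+ 2 +
                      dPhi p (u s x) * L (L (u s)) x))
  (fun x => C * (2 * M) ^+ 2 * (pi x * W x ^+ 2) + C * (2 * M) * (pi x * V x)) _ t0).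
- move=> s s0; apply: (le_summ hX (fun x => dW s x s0)).
  by apply: summZ; exact: (summ_pi_weight hX tame).
- move=> s x s0; have d1 := du x s0; have d2 := is_derive_dPhi hp (u0 x s0).
  have d3 := is_derive_generator_evolve x s0.
  rewrite (_ : (fun s => _) = pi x *: ((dPhi p \o (u ^~ x)) * (fun s => L (u s) x))).
    apply: is_derive_eq; rewrite /GRing.scale/=; ring.
  by apply/funext => r; rewrite !fctE.
- move=> s x s0; have [_ h2 h3] := hC _ (umM x s0).
  rewrite normrM (gtr0_norm (pi0 x)).
  rewrite [leRHS](_ : _ = pi x * (C * (2 * M * W x) ^+ 2 + C * (2 * M * V x))); last by ring.
  rewrite ler_wpM2l ?(ltW (pi0 x))// (le_trans (ler_normD _ _))// lerD//.
    rewrite normrM normrX ler_pM ?exprn_ge0// lerXn2r ?nnegrE ?LW//.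
    by apply: le_trans (LW s x s0).
  rewrite normrM ler_pM//.
  by apply: (generator_weight2 hX tame) => y; exact: LW.
- apply: summD; apply: summZ; [exact: (tame_weight tame)|exact: (tame_weight2 tame)].
Qed.

End DerivativeUnderSum.

(** * The chain and its moments *)

Section ChainTransitions.
Context {R : realType} {d : measure_display} {X : measurableType d}
  {d' : measure_display} {Omega : measurableType d'}.
Hypothesis hX : countable_discrete X.
Local Notation cnt := (@counting X R).
Variables (k : X -> X -> R) (Pr : X -> probability Omega R)
  (Z : R -> Omega -> option X).
Hypothesis hZ : is_markov_chain Pr Z k.

Definition transition (t : R) (x y : X) : R := fine (Pr x (at_state Z t y)).

Lemma transitionE (t : R) x y : 0 <= t ->
  Pr x (at_state Z t y) = (transition t x y)%:E.
Proof.
move=> t0; rewrite /transition fineK// fin_num_measure//.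
exact: (chain_measurable hZ).
Qed.

(** The events [at_state Z t y] are disjoint, and outside them the path is in the cemetery, where
    [f] is extended by [0]. *)
Lemma semigroup_sum (t : R) f x : 0 <= t -> (forall y, 0 <= f y) ->
  semigroup Pr Z t f x = \int[cnt]_y (transition t x y * f y).
Proof.
move=> t0 f0; rewrite /semigroup unlock /Rintegral; congr fine.
rewrite (integral_countable_partition hX (Pr x) (F := at_state Z t)
  (g := fun y => (f y)%:E)).
- by apply: eq_integral => y _; rewrite EFinM -transitionE// muleC.
- by move=> y; exact: (chain_measurable hZ).
- by move=> y z w; rewrite /at_state /= => -> [].
- by move=> y; rewrite lee_fin.
- by move=> y w; rewrite /at_state /= => ->.
- move=> w; rewrite /at_state /=; case: (Z t w) => //= y /(_ y) h.
  by case: h.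
Qed.

(** Split according to the state at time [s] and apply the Markov property with empty history. *)
Lemma chapman_kolmogorov (s t : R) x z : 0 <= s -> 0 <= t ->
  transition (s + t) x z = \int[cnt]_y (transition s x y * transition t y z).
Proof.
move=> s0 t0; rewrite {1}/transition /Rintegral; congr fine.
have mz : measurable (at_state Z (s + t) z).
  by apply: (chain_measurable hZ); exact: addr_ge0.
have -> : Pr x (at_state Z (s + t) z) =
    (\int[Pr x]_w (\1_(at_state Z (s + t) z) w)%:E)%E.
  by rewrite integral_indic// setIT.
rewrite (integral_countable_partition hX (Pr x) (g := fun=> 1%E)
  (F := fun y => at_state Z s y `&` at_state Z (s + t) z)).
- apply: eq_integral => y _; rewrite mul1e EFinM -!transitionE//.
  have := chain_markov hZ x (h := [::]) y z s0 t0.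
  have -> : history Z [::] = setT by apply/seteqP; split => // w _ u.
  by rewrite !setTI; apply => u.
- by move=> y; apply: measurableI => //; exact: (chain_measurable hZ).
- by move=> y y' w [+ _] [+ _]; rewrite /at_state /= => -> [].
- by move=> y.
- by move=> y w [_ h]; rewrite indicE mem_set.
- move=> w h; rewrite indicE memNset// => zw.
  (* A path in the cemetery at time [s] remains there and cannot be at [z] at time [s + t]. *)
  case Zs: (Z s w) => [y|]; first exact: (h y).
  have := path_cemetery (chain_paths hZ w) s0 _ Zs (t := s + t).
  by rewrite lerDl => /(_ t0); rewrite zw.
Qed.

Hypothesis hk : is_rates k.
Hypothesis hP : markov_semigroup Pr Z.

Definition offdiag x y : R := if y == x then 0 else k x y.

Lemma offdiag_ge0 x y : 0 <= offdiag x y.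
Proof.
rewrite /offdiag; case: eqP => // /eqP yx; apply: (rates_ge0 hk).
by rewrite eq_sym.
Qed.

Lemma integral_offdiag x (g : X -> R) :
  (\int[cnt]_(y in ~` [set x]) ((k x y)%:E * (g y)%:E) =
   \int[cnt]_y (offdiag x y * g y)%:E)%E.
Proof.
rewrite integral_mkcond; apply: eq_integral => y _.
rewrite patchE /offdiag; case: ifPn; rewrite ?notin_setE ?inE/=.
  by move=> /eqP/negbTE ->; rewrite EFinM.
by move=> /contrapT ->; rewrite eqxx mul0r.
Qed.

Lemma M1_offdiag x : (M1 k x = \int[cnt]_y (offdiag x y)%:E)%E.
Proof.
rewrite /M1; under eq_integral do rewrite -[(k x _)%:E]mule1.
rewrite (integral_offdiag x (fun=> 1)).
by apply: eq_integral => y _; rewrite mulr1.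
Qed.

Lemma summ_offdiag x : summ (offdiag x).
Proof.
by apply/(summ_lty hX); [exact: offdiag_ge0|rewrite -M1_offdiag (rates_M1 hk)].
Qed.

Lemma sum_offdiag x : \int[cnt]_y offdiag x y = - k x x.
Proof. by rewrite (rates_diag hk) opprK M1_offdiag. Qed.

Lemma M1E x : (M1 k x = (- k x x)%:E)%E.
Proof. by rewrite -sum_offdiag -EFin_sum ?M1_offdiag//; exact: summ_offdiag. Qed.

Lemma rates_split x y : k x y = offdiag x y + (if y == x then k x x else 0).
Proof. by rewrite /offdiag; case: eqP => [->|_]; ring. Qed.

Lemma norm_rates_split x y :
  `|k x y| = offdiag x y + (if y == x then - k x x else 0).
Proof.
have h := offdiag_ge0 x y; move: h; rewrite /offdiag; case: eqP => [->|_] h.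
  by rewrite add0r ltr0_norm// (rates_diag_lt0 hk).
by rewrite addr0 ger0_norm.
Qed.

Lemma summ_rates x : summ (k x).
Proof.
rewrite (funext (rates_split x)); apply: summD; first exact: summ_offdiag.
by case: (summ_atom hX x (k x x)).
Qed.

Lemma chain_transition_function : transition_function k transition.
Proof.
have sumP (t : R) x : 0 <= t ->
    (\int[cnt]_y (transition t x y)%:E)%E = 1%:E.
  move=> t0; have := congr1 (fun g => g x) (hP t0).
  rewrite semigroup_sum//= /Rintegral; under eq_integral do rewrite mulr1.
  (* [fine] sends infinite values to [0], so the real value [1] excludes them. *)
  case: (\int[cnt]_y _)%E => [r /= ->//| |] /= /esym/eqP; by rewrite oner_eq0.
have P0 (t : R) x y : 0 <= transition t x y by rewrite fine_ge0.
split => //.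
- by move=> t x t0; apply/(summ_lty hX) => //; rewrite sumP// ltry.
- by move=> t x t0; rewrite /Rintegral sumP.
- exact: chapman_kolmogorov.
- exact: (chain_rates hZ).
- exact: (rates_ge0 hk).
- exact: summ_rates.
- move=> x; have [s1 e1] := summ_atom hX x (k x x).
  under eq_Rintegral do rewrite rates_split.
  by rewrite sumSD ?e1 ?sum_offdiag ?addNr//; exact: summ_offdiag.
Qed.

Lemma weightE x : weight k x = 1 + 2 * (- k x x).
Proof.
have [s1 e1] := summ_atom hX x (- k x x).
rewrite /weight; under eq_Rintegral do rewrite norm_rates_split.
by rewrite sumSD ?e1 ?sum_offdiag//; [ring|exact: summ_offdiag].
Qed.

Lemma summ_offdiag_rates x : summ (fun y => offdiag x y * (- k y y)).
Proof.
apply/(summ_lty hX) => [y|].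
  by rewrite mulr_ge0 ?offdiag_ge0// oppr_ge0 ltW// (rates_diag_lt0 hk).
rewrite -(integral_offdiag x (fun y => - k y y)).
by under eq_integral do rewrite -M1E; exact: (rates_M2 hk).
Qed.

Lemma M2E x : (M2 k x = (\int[cnt]_y (offdiag x y * (- k y y)))%:E)%E.
Proof.
rewrite -EFin_sum; last exact: summ_offdiag_rates.
rewrite /M2 -(integral_offdiag x (fun y => - k y y)).
by under eq_integral do rewrite M1E.
Qed.

Lemma summ_rates_weight x :
  summ (fun y => `|k x y| * weight k y) /\
  \int[cnt]_y (`|k x y| * weight k y) =
  - k x x + 2 * fine (M2 k x) + - k x x * weight k x.
Proof.
have [s1 e1] := summ_atom hX x (- k x x * weight k x).
have E y : `|k x y| * weight k y = offdiag x y +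
    2 * (offdiag x y * (- k y y)) + (if y == x then - k x x * weight k x else 0).
  by rewrite norm_rates_split weightE; case: eqP => [->|_]; rewrite ?weightE; ring.
have s2 := summ_offdiag x; have s3 := summ_offdiag_rates x.
have s4 := summD s2 (summZ 2 s3).
split; first by rewrite (funext E); exact: summD.
rewrite (eq_Rintegral _ (fun y _ => E y)) sumSD// sumSD//; last exact: summZ.
by rewrite sumSZ// sum_offdiag e1 M2E.
Qed.

Variables (mu : probability X R) (pi : X -> R).
Hypothesis hpi : has_density mu pi.
Hypothesis hdb : detailed_balance k pi.
Hypothesis hM1 : ('N[mu]_(2%:E)[M1 k] < +oo)%E.
Hypothesis hM2 : ('N[mu]_(1%:E)[M2 k] < +oo)%E.

Lemma summ_density_of (g : X -> R) : (forall x, 0 <= g x) ->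
  (\int[mu]_x (g x)%:E < +oo)%E -> summ (fun x => pi x * g x).
Proof.
move=> g0 gy; have pi0 x := ltW (hpi.1 x).
apply/(summ_lty hX) => [x|]; first exact: mulr_ge0.
move: gy; rewrite (ge0_integral_density hX hpi); last by move=> x; rewrite lee_fin.
by under [X in (X < _)%E -> _]eq_integral do rewrite -EFinM mulrC.
Qed.

(** With [q x = - k x x], the value of [M1], the weights are [W = 1 + 2 q] and
    [V = 4 q + 6 q^2 + 2 M2]. Integrability of [q] itself follows from that of [q^2] through
    [q <= 1 + q^2]. *)
Lemma chain_tame_rates : tame_rates k pi.
Proof.
have pi0 x := ltW (hpi.1 x).
have q0 x : 0 <= - k x x by rewrite oppr_ge0 ltW// (rates_diag_lt0 hk).
have s1 : summ pi.
  rewrite (_ : pi = fun x => pi x * 1); last by apply/funext => x; rewrite mulr1.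
  by apply: summ_density_of => //; rewrite integral_cst// mul1e (le_lt_trans (probability_le1 _ _)) ?ltry.
have s2 : summ (fun x => pi x * (- k x x) ^+ 2).
  apply: summ_density_of => [x|]; first exact: sqr_ge0.
  have := powR_Lnorm mu (M1 k) (r := 2).
  rewrite pnatr_eq0 => /(_ isT).
  under eq_integral do rewrite M1E gee0_abs ?lee_fin// poweR_EFin powR_mulrn//.
  by move=> <-; exact: poweR_lty.
have s3 : summ (fun x => pi x * fine (M2 k x)).
  have M20 x : 0 <= fine (M2 k x).
    rewrite M2E; apply: Rintegral_ge0 => y _.
    by rewrite mulr_ge0 ?offdiag_ge0.
  apply: summ_density_of => //.
  move: hM2; rewrite Lnorm1.
  have absM2 x : (`|M2 k x| = (fine (M2 k x))%:E)%E.
    by have := M20 x; rewrite M2E /= => h; rewrite ger0_norm.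
  by under eq_integral do rewrite absM2.
have s4 : summ (fun x => pi x * - k x x).
  apply: (le_summ hX _ (summD s1 s2)) => x; rewrite ger0_norm ?mulr_ge0//.
  by rewrite -[X in X + _]mulr1 -mulrDr ler_wpM2l//; nra.
split => //.
- exact: summ_rates.
- by move=> x; case: (summ_rates_weight x).
- exact: hpi.1.
- rewrite (_ : (fun x => _) = (fun x => pi x + 4 * (pi x * - k x x) +
     4 * (pi x * (- k x x) ^+ 2))).
    by apply: summD; [apply: summD => //|]; exact: summZ.
  by apply/funext => x; rewrite weightE; ring.
- have E x : pi x * weight2 k x = 4 * (pi x * - k x x) +
      6 * (pi x * (- k x x) ^+ 2) + 2 * (pi x * fine (M2 k x)).
    have [t1 t2] := summ_rates_weight x.
    have sk := summ_norm (summ_rates x).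
    have NE : \int[cnt]_y `|k x y| = 2 * (- k x x).
      by have := weightE x; rewrite /weight => /addrI.
    rewrite /weight2; under eq_Rintegral do rewrite mulrDr mulrC.
    by rewrite sumSD// ?sumSZ// ?t2 ?NE ?weightE; [ring|exact: summZ].
  by rewrite (funext E); apply: summD; [apply: summD|]; exact: summZ.
Qed.

End ChainTransitions.

(** * Two-sided bounds on densities, and the conclusion for the chain *)

Lemma linfty_pos_bounds {R : realType} {d : measure_display}
    {X : measurableType d} (f : X -> R) : linfty_pos f ->
  (exists x : X, True) /\ exists m M : R, 0 < m /\ forall x, m <= f x <= M.
Proof.
move=> [[M [_ hM]] inf0]; split.
  have [[_ [x _ _]]|/set0P/negP/negPn/eqP f0] := pselect (range f !=set0).
    by exists x.
  (* The infimum of the empty set is [0] by default, so a positive infimum forces [X] to be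
     inhabited. *)
  by move: inf0; rewrite f0 inf0 ltxx.
(* [bounded_fun] provides the bound only for reals strictly above [M]. *)
have fM x : `|f x| <= M + 1 by apply: hM => //; rewrite ltrDl.
exists (inf (range f)), (M + 1); split => // x; apply/andP; split.
  apply: ge_inf; last by exists x.
  by exists (- (M + 1)) => _ [y _ <-]; have := fM y; rewrite ler_norml => /andP[].
by rewrite (le_trans (ler_norm _)).
Qed.

Lemma bounds_linfty_pos {R : realType} {d : measure_display}
    {X : measurableType d} (f : X -> R) (m M : R) : (exists x : X, True) ->
  0 < m -> (forall x, m <= f x <= M) -> linfty_pos f.
Proof.
move=> [x0 _] m0 fmM; split.
  exists M; split; first exact: num_real.
  move=> r Mr x _ /=; case/andP: (fmM x) => mf fM.
  by rewrite ger0_norm ?(le_trans fM) ?ltW// (lt_le_trans m0).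
apply: (lt_le_trans m0); apply: lb_le_inf; first by exists (f x0), x0.
by move=> _ [x _ <-]; case/andP: (fmM x).
Qed.

Theorem theorem6p8 (R : realType)
  (d : measure_display) (X : measurableType d)
  (d' : measure_display) (Omega : measurableType d')
  (k : X -> X -> R)
  (Pr : X -> probability Omega R) (Z : R -> Omega -> option X)
  (mu : probability X R) (pi : X -> R) (p : R)
  (hX : countable_discrete X)
  (hk : is_rates k)
  (hirr : irreducible k)
  (hZ : is_markov_chain Pr Z k)
  (hP : markov_semigroup Pr Z)
  (hinv : is_invariant Pr Z mu)
  (hpi : has_density mu pi)
  (hdb : detailed_balance k pi)
  (hp : 1 < p < 2)
  (hM1 : ('N[mu]_(2%:E)[M1 k] < +oo)%E)
  (hM2 : ('N[mu]_(1%:E)[M2 k] < +oo)%E) :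
  (forall (f : X -> R) (t : R), prob_densities pi f -> 0 < t ->
     is_derive t 1 (fun s => entropy pi p (semigroup Pr Z s f))
       (- fisher k mu p (semigroup Pr Z t f)) /\
     is_derive t 1 (fun s => entropy pi p (semigroup Pr Z s f))^`()%classic
       (2 * \int[mu]_x (semigroup Pr Z t f x *
                        Psi2 k p (semigroup Pr Z t f) x))) /\
  (forall kappa : R, CD_Upsilon k p kappa ->
     forall (f : X -> R) (t : R), 0 < t -> prob_densities pi f ->
     (fun s => entropy pi p (semigroup Pr Z s f))^`(2)%classic t >=
       - 2 * kappa * (fun s => entropy pi p (semigroup Pr Z s f))^`()%classic t).
Proof.
have tf := chain_transition_function hX hZ hk hP.
have tame := chain_tame_rates hX hk hpi hdb hM1 hM2.
have pi0 x := ltW (hpi.1 x).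
have p2 : 2 - p != 0 by case/andP: hp => _ h; rewrite subr_eq0 gt_eqF.
have main (f : X -> R) (t : R) : linfty_pos f -> 0 < t ->
    [/\ linfty_pos (semigroup Pr Z t f),
      is_derive t 1 (fun s => entropy pi p (semigroup Pr Z s f))
       (- fisher k mu p (semigroup Pr Z t f)),
      is_derive t 1 (fun s => entropy pi p (semigroup Pr Z s f))^`()%classic
       (2 * \int[mu]_x (semigroup Pr Z t f x *
                        Psi2 k p (semigroup Pr Z t f) x)),
      summ (fun x => semigroup Pr Z t f x * Psi k p (semigroup Pr Z t f) x * pi x) &
      summ (fun x => semigroup Pr Z t f x * Psi2 k p (semigroup Pr Z t f) x * pi x)].
  move=> /linfty_pos_bounds[X0 [m [M [m0 fmM]]]] t0.
  have f0 x : 0 <= f x by case/andP: (fmM x) => h _; exact: le_trans (ltW m0) h.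
  pose u := evolve (transition Pr Z) f.
  (* Agreement at positive times suffices, because a derivative at [s > 0] depends only on nearby
     times. *)
  have uE (s : R) : 0 < s -> semigroup Pr Z s f = u s.
    by move=> s0; apply/funext => x; exact: (semigroup_sum hX hZ x (ltW s0) f0).
  have umM (s : R) : 0 < s -> forall x, m <= u s x <= M.
    by move=> s0 x; apply: (evolve_bounds hX tf fmM); exact: ltW.
  pose H1 s := \int[counting]_x (pi x * (dPhi p (u s x) * generator k (u s) x)).
  have dH (s : R) : 0 < s ->
      is_derive s 1 (fun s => entropy pi p (semigroup Pr Z s f)) (H1 s).
    move=> s0; have [d1 _] := entropy_derivatives hX tf tame hp m0 fmM s0.
    apply: near_eq_is_derive d1; near=> r.
    by rewrite /entropy uE//; near: r; exact: lt_nbhsr.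
  rewrite !uE//.
  have [sPsi ePsi] := sum_mul_Psi hX tame hp m0 (umM t t0).
  have [sPsi2 ePsi2] := sum_mul_Psi2 hX tame hp m0 (umM t t0).
  split => //.
  - exact: bounds_linfty_pos X0 m0 (umM t t0).
  - rewrite /fisher (Rintegral_density hX _ hpi) ePsi.
    rewrite (_ : - _ = H1 t); first exact: dH.
    by rewrite mulNr mulrN opprK mulrA mulVf// mul1r.
  - rewrite (Rintegral_density hX _ hpi) ePsi2.
    have [_ d2] := entropy_derivatives hX tf tame hp m0 fmM t0.
    (* By [dH], the derivative of the entropy coincides with [H1] near [t], so it may be replaced by
       [H1]. *)
    apply: near_eq_is_derive d2; near=> r.
    have r0 : 0 < r by near: r; exact: lt_nbhsr.
    by have [_ e] := dH r r0; rewrite derive1E e.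
split=> [f t [fb _] t0|kappa CD f t t0 [fb _]].
  by have [_ d1 d2 _ _] := main f t fb t0.
have [ub d1 d2 s1 s2] := main f t fb t0.
have -> : (fun s => entropy pi p (semigroup Pr Z s f))^`(2)%classic t =
    2 * \int[mu]_x (semigroup Pr Z t f x * Psi2 k p (semigroup Pr Z t f) x).
  by case: d2 => _ <-; rewrite -derive1E.
have -> : (fun s => entropy pi p (semigroup Pr Z s f))^`()%classic t =
    - fisher k mu p (semigroup Pr Z t f).
  by case: d1 => _ <-; rewrite derive1E.
rewrite /fisher !(Rintegral_density hX _ hpi).
(* The two minus signs cancel, and the inequality reduces to the pointwise bound [CD] multiplied by
   the nonnegative weight [P_t f * pi]; [s1] and [s2] make both sides summable. *)
rewrite [leLHS](_ : _ = 2 * \int[counting]_x (kappa / (2 - p) *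
  (semigroup Pr Z t f x * Psi k p (semigroup Pr Z t f) x * pi x))).
  rewrite ler_wpM2l//; apply: ler_sumS => //; first exact: summZ.
  move=> x; have := CD _ x ub.
  have u0 : 0 <= semigroup Pr Z t f x * pi x.
    rewrite mulr_ge0//; have [_ [m [M [m0 h]]]] := linfty_pos_bounds ub.
    by case/andP: (h x) => h1 _; exact: le_trans (ltW m0) h1.
  move=> /(ler_wpM2l u0); congr (_ <= _); ring.
by rewrite sumSZ//; ring.
Unshelve. all: by end_near.
Qed.
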